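(* Consider the duplicated redundant system with renewal described in the context, with primary unit failure rate $\lambda$, standby unit failure rate $\lambda'$ and repair time distribution function $G$. Let $q=1-\int_0^\infty e^{-\lambda x}\,dG(x)$, and let $\alpha_0$ and $\alpha_1$ be the total times spent by the system in state $0$ and in state $1$, respectively, during the first busy period. Then for all $t\ge0$ $$\mathbf{P}(\alpha_0>t)=e^{-(\lambda+\lambda')qt},\qquad \mathbf{P}(\alpha_1>t)=e^{-\lambda t}.$$
   Context: The system consists of one operating (primary) unit, one standby unit and one repair unit. The failure-free time of the operating unit is exponential with parameter $\lambda>0$; a unit in (light) standby can also fail, with failure-free time exponential with parameter $\lambda'$, $0<\lambda'<\lambda$; the repair time has an arbitrary distribution function $G(t)=\mathbf{P}(\eta<t)$ with $G(0+)=0$. All failure-free times and repair times are independent. A failed operating unit is immediately replaced by the standby unit if that one is good; a failed unit is repaired (one at a time), after which it is as good as new. Let $\xi(t)\in\{0,1,2\}$ be the number of defective units at time $t$, with $\xi(0)=0$ a.s.; the system is in state $k$ at time $t$ if $\xi(t)=k$. Explicitly: in state $0$ the operating unit and the standby unit have independent exponential($\lambda$) and exponential($\lambda'$) lifetimes, and at the first of the two failures the system enters state $1$; on entering state $1$ the good unit operates with remaining lifetime exponential($\lambda$) (memorylessness), and a repair with a new independent repair time distributed as $\eta$ starts for the other unit; if the repair ends before the operating unit fails the system returns to state $0$, otherwise at the failure of the operating unit the system enters state $2$. The first busy period is the time interval from time $0$ to the first entry to state $2$. *)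

(* Defs.v *)
From HB Require Import structures.
From mathcomp Require Import all_boot all_order all_algebra.
From mathcomp Require Import all_classical all_reals all_analysis.

Set Implicit Arguments.
Unset Strict Implicit.
Unset Printing Implicit Defensive.

Import Order.TTheory GRing.Theory Num.Theory.
Import numFieldNormedType.Exports.

Local Open Scope classical_set_scope.
Local Open Scope ring_scope.

(* Mutual independence: the product rule over every finite subfamily. *)
Definition mutually_independent (d : measure_display) (T : measurableType d)
    (R : realType) (P : probability T R) (I : eqType) (X : I -> {RV P >-> R}) :
    Prop :=
  forall (J : seq I) (A : I -> set R),
    uniq J -> (forall i, measurable (A i)) ->
    P (\bigcap_(i in [set` J]) (X i @^-1` A i)) =
    (\prod_(i <- J) P (X i @^-1` A i))%E.

Definition gather3 (A : Type) (X Y Z : nat -> A) (i : nat + nat + nat) : A :=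
  match i with
  | inl (inl n) => X n
  | inl (inr n) => Y n
  | inr n => Z n
  end.

(* Configurations of the system, with residual times of the running clocks. *)
Inductive config (R : realType) : Type :=
| Both of R & R   (* state 0: residual operating life, residual standby life *)
| One of R & R    (* state 1: residual operating life, residual repair time *)
| Down of R.      (* state 2: residual repair time *)

Arguments Both {R}.
Arguments One {R}.
Arguments Down {R}.

Section Path.
Variable R : realType.

Definition state_of (c : config R) : nat :=
  match c with Both _ _ => 0 | One _ _ => 1 | Down _ => 2 end.

(* Time spent in the configuration before the next jump. *)
Definition holding (c : config R) : R :=
  match c with
  | Both x y => Num.min x y
  | One x r => Num.min x r
  | Down r => r
  end.

(* One jump.  The clocks that are started at the jump read the fresh values
   l (a unit is put into operation), s (a unit is put into standby) and
   g (a repair begins); the fresh values that are not needed are discarded,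
   and the clocks that keep running are decreased by the holding time. *)
Definition jump (l s g : R) (c : config R) : config R :=
  match c with
  | Both x y =>
      if y < x then One (x - y) g   (* the standby unit fails *)
      else One l g                  (* the operating unit fails *)
  | One x r =>
      if r < x then Both (x - r) s  (* the repair ends first *)
      else Down (r - x)             (* the operating unit fails *)
  | Down _ => One l g               (* repaired unit operates, other repaired *)
  end.

(* A trajectory of the system is determined by the values l n, s n, g n of the
   operating life, standby life and repair time available at the n-th jump
   (n = 0 being the start at time 0). *)
Variables l s g : nat -> R.

Fixpoint conf (n : nat) : config R :=
  if n is m.+1 then jump (l n) (s n) (g n) (conf m) else Both (l 0%N) (s 0%N).

(* Epoch of the n-th jump, i.e. of the entry to [conf n]. *)
Definition epoch (n : nat) : R := \sum_(i < n) holding (conf i).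

(* The number of jumps up to time t.  The default value 0 is only used at times
   after an accumulation of jumps, which has probability zero. *)
Definition jumps (t : R) : nat :=
  xget 0%N [set n | t < epoch n.+1 /\
                    forall m, (m < n)%N -> epoch m.+1 <= t].

(* xi(t), the number of defective units at time t *)
Definition xi (t : R) : nat := state_of (conf (jumps t)).

(* The first entry to state 2, +oo if there is none. *)
Definition busy_end : \bar R :=
  ereal_inf [set t%:E | t in [set t : R | 0 <= t /\ xi t = 2%N]].

(* alpha k: total time spent in state k during the first busy period *)
Definition alpha (k : nat) : \bar R :=
  lebesgue_measure [set t : R | 0 <= t /\ (t%:E < busy_end)%E /\ xi t = k].

End Path.

(* Main.v *)
Require Import Defs.
From HB Require Import structures.
From mathcomp Require Import all_boot all_order all_algebra.
From mathcomp Require Import all_classical all_reals all_analysis.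
From mathcomp Require Import measurable_realfun ring lra.

Set Implicit Arguments.
Unset Strict Implicit.
Unset Printing Implicit Defensive.

Import Order.TTheory GRing.Theory Num.Theory.
Import numFieldNormedType.Exports.

Local Open Scope classical_set_scope.
Local Open Scope ring_scope.

(** The first busy period is cut into cycles, one stay in state 0 followed by
    one stay in state 1. The lengths of the j-th stays are [stay0 j] and
    [stay1 j], and cycle j is the last one when the repair outlasts the residual
    operating life [oplife1 j] with which state 1 was entered. So alpha_0 and
    alpha_1 are sums of stays over a random number of cycles ([alpha_cycles]).

    Memorylessness makes every cycle start afresh. A life that exceeds the repair
    time exceeds it by a fresh life ([overshoot_fresh]); hence at each entry to
    state 0 the operating unit has an exponential residual life independent of
    the past ([fresh_life_all]). Likewise the good unit enters state 1 with a
    fresh life, independent of the length of the stay in state 0 that has just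
    ended ([residual_fresh]).

    The law of the random sum need not be computed. Let u be the claimed tail,
    continued by 1 to negative arguments, and let c be the contribution of one
    cycle to alpha. Suppose that u is balanced over one cycle:
      u(t) = P(the cycle is the last one, c > t)
             + E[u(t - c); the cycle is not the last one]   for all real t.
    Then Q_j = E[u(t - contribution of the first j cycles); cycle j takes place]
    satisfies Q_j = Q_(j+1) + P(cycle j is the last one, alpha > t)
    ([balance_step]). As cycle j takes place with probability (1 - q)^j, which
    tends to 0, summation gives P(alpha > t) = Q_0 = u(t) ([prob_last_cycle]).

    Both tails are balanced. In state 1 the stay is the minimum of a life and a
    repair time; by memorylessness a life that survives the repair is the repair
    time plus a fresh life, and this is the balance equation ([race_balance]).
    In state 0 the stay is exponential with rate lambda + lambda' and is
    independent of the race that follows, which ends in a failure with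
    probability q; so the number of stays is geometric and the balance equation
    is the thinning of a Poisson process ([first_failure_balance]).

    The occupation times are defined for every outcome, including those with
    nonpositive clocks, so the measurability of the events alpha > t requires an
    argument about arbitrary trajectories ([measurable_alpha]). *)

(** * The trajectory, cycle by cycle *)

Lemma sum_ord_recr_cond (V : nmodType) (m : nat) (p : pred nat) (F : nat -> V) :
  \sum_(n < m.+1 | p n) F n = \sum_(n < m | p n) F n + (if p m then F m else 0).
Proof. by rewrite big_mkcond big_ord_recr /= -big_mkcond. Qed.

Section Cycles.
Variables (R : realType) (l s g : nat -> R).

(** The residual life of the good unit at the first failure of a pair with
    residual operating life x and standby life y: if the operating unit fails,
    the other one gets the fresh operating life z. *)
Definition residual (x y z : R) : R := if y < x then x - y else z.

(** Residual operating life at the start of cycle j, and at its entry to state 1.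
    The indices of l, s and g are those of the jumps: cycle j uses jumps 2j and
    2j + 1. The recursion ignores failures; it describes the trajectory only as
    long as [alive] holds. *)
Fixpoint oplife0 (j : nat) : R :=
  if j is i.+1 then residual (oplife0 i) (s i.*2) (l i.*2.+1) - g i.*2.+1 else l 0%N.

Definition oplife1 (j : nat) : R := residual (oplife0 j) (s j.*2) (l j.*2.+1).

Lemma oplife1E j : oplife1 j = residual (oplife0 j) (s j.*2) (l j.*2.+1).
Proof. by []. Qed.

Definition stay0 (j : nat) : R := Num.min (oplife0 j) (s j.*2).
Definition stay1 (j : nat) : R := Num.min (oplife1 j) (g j.*2.+1).

(** No failure of the system in the first j cycles. *)
Fixpoint alive (j : nat) : bool :=
  if j is i.+1 then alive i && (g i.*2.+1 < oplife1 i) else true.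

Definition acc (c : R -> R -> R) (j : nat) : R :=
  \sum_(i < j) c (stay0 i) (stay1 i).

Lemma confS (n : nat) :
  conf l s g n.+1 = jump (l n.+1) (s n.+1) (g n.+1) (conf l s g n).
Proof. by []. Qed.

Lemma conf_cycle (j : nat) : alive j ->
  conf l s g j.*2 = Both (oplife0 j) (s j.*2) /\
  conf l s g j.*2.+1 = One (oplife1 j) (g j.*2.+1).
Proof.
elim: j => [_|j IH]; first by split=> //=; rewrite /oplife1 /residual /=; case: ifP.
rewrite {1}/alive -/alive => /andP[/IH[_ c1] gx].
have c2 : conf l s g j.+1.*2 = Both (oplife0 j.+1) (s j.+1.*2).
  by rewrite doubleS confS c1 /= gx.
by split=> //; rewrite confS c2 /= /oplife1 /residual; case: ifP.
Qed.

Lemma conf_down (j : nat) : alive j -> oplife1 j <= g j.*2.+1 ->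
  conf l s g j.+1.*2 = Down (g j.*2.+1 - oplife1 j).
Proof.
move=> aj xg; have [_ c1] := conf_cycle aj.
by rewrite doubleS confS c1 /= ltNge xg.
Qed.

Lemma alive_le (i j : nat) : (i <= j)%N -> alive j -> alive i.
Proof.
move=> ij; rewrite -(subnK ij); elim: (j - i)%N => //= n IH /andP[+ _].
exact: IH.
Qed.

Variable M : nat.
Hypothesis hold_gt0 : forall n, (n <= M)%N -> 0 < holding (conf l s g n).

Local Notation epoch := (epoch l s g).
Local Notation xi := (xi l s g).

Lemma epochS n : epoch n.+1 = epoch n + holding (conf l s g n).
Proof. by rewrite /Defs.epoch big_ord_recr. Qed.

Lemma epoch_le m n : (m <= n)%N -> (n <= M.+1)%N -> epoch m <= epoch n.
Proof.
move=> mn; rewrite -(subnK mn); elim: (n - m)%N => //= k IH kM.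
rewrite addSn epochS; apply: ler_wpDr; last by apply: IH; exact: ltnW.
by apply/ltW/hold_gt0; rewrite -ltnS -addSn.
Qed.

(** Positive holding times make the epochs strictly increasing, so that the jump
    count can be read off the interval of epochs that contains t. *)
Lemma xi_at n t : (n <= M)%N -> epoch n <= t < epoch n.+1 ->
  xi t = state_of (conf l s g n).
Proof.
move=> nM /andP[nt tn]; rewrite /Defs.xi; congr (state_of (conf _ _ _ _)).
apply: xget_unique => /=.
  split=> // m mn; apply: le_trans nt; apply: epoch_le => //.
  exact: leqW.
move=> k [tk km]; case: (ltngtP k n) => // [kn|nk].
- have := lt_le_trans tk (epoch_le kn (leqW nM)).
  by rewrite ltNge nt.
- by have := le_lt_trans (km _ nk) tn; rewrite ltxx.
Qed.

Lemma epoch_between m t : (m <= M.+1)%N -> 0 <= t -> t < epoch m ->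
  exists2 n, (n < m)%N & epoch n <= t < epoch n.+1.
Proof.
elim: m => [|m IH] mM t0 tm.
  by move: tm; rewrite /Defs.epoch big_ord0 ltNge t0.
have [tm'|mt] := ltP t (epoch m).
  by have [n nm nt] := IH (ltnW mM) t0 tm'; exists n => //; exact: leqW.
by exists m => //; rewrite mt.
Qed.

Lemma occupation (k m : nat) : (m <= M.+1)%N ->
  let A := [set t : R | 0 <= t /\ t < epoch m /\ xi t = k] in
  measurable A /\ lebesgue_measure A =
    (\sum_(n < m | state_of (conf l s g n) == k) holding (conf l s g n))%:E.
Proof.
elim: m => [_|m IH mM] A.
  have -> : A = set0.
    rewrite -subset0 => t [t0 [+ _]].
    by rewrite /Defs.epoch big_ord0 ltNge t0.
  by rewrite measure0 big_ord0.
have [mB BE] := IH (ltnW mM).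
set B := [set t : R | _] in mB BE.
pose C := if state_of (conf l s g m) == k then `[epoch m, epoch m.+1[%classic
          else set0.
have mC : measurable C by rewrite /C; case: ifP.
have em0 : 0 <= epoch m.
  by have := epoch_le (leq0n m) (ltnW mM); rewrite {1}/Defs.epoch big_ord0.
have AE : A = B `|` C.
  apply/seteqP; split=> [t [t0 [tm xk]]|t [[t0 [tm xk]]|]].
  - have [tm'|mt] := ltP t (epoch m); [by left|right].
    have tE : epoch m <= t < epoch m.+1 by rewrite mt.
    by rewrite /C -xk (xi_at _ tE)// eqxx /= in_itv.
  - split=> //; split=> //; apply: lt_le_trans tm _.
    by rewrite epoch_le.
  - rewrite /C; case: ifP => // /eqP kE; rewrite /= in_itv /= => tE.
    have [mt tm] := andP tE; split; first exact: le_trans mt.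
    by split=> //; rewrite (xi_at _ tE).
rewrite AE; split; first exact: measurableU.
rewrite measureU//; last first.
  rewrite -subset0 => t [[_ [tm _]]]; rewrite /C; case: ifP => // _.
  by rewrite /= in_itv /= leNgt tm.
rewrite (@sum_ord_recr_cond _ m (fun n => state_of (conf l s g n) == k)
  (fun n => holding (conf l s g n))).
rewrite [RHS]EFinD; congr (_ + _)%E; first exact: BE.
rewrite /C; case: (_ == k); last by rewrite measure0.
apply: (etrans (lebesgue_measure_itv _)); rewrite /= lte_fin epochS ltrDl hold_gt0//.
by rewrite -EFinB addrAC subrr add0r.
Qed.

Hypothesis downM : state_of (conf l s g M) = 2%N.
Hypothesis upM : forall n, (n < M)%N -> state_of (conf l s g n) <> 2%N.

Lemma busy_endE : busy_end l s g = (epoch M)%:E.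
Proof.
have e0 : 0 <= epoch M.
  by have := epoch_le (leq0n M) (leqnSn M); rewrite {1}/Defs.epoch big_ord0.
apply/eqP; rewrite eq_le; apply/andP; split.
  apply: ereal_inf_lbound => /=; exists (epoch M) => //; split=> //.
  by rewrite (xi_at (leqnn M)) ?downM// lexx epochS ltrDl hold_gt0.
apply/le_ereal_inf_tmp => _ [t [t0 xt] <-]; rewrite lee_fin leNgt; apply/negP => tM.
have [n nM nt] := epoch_between (leqnSn M) t0 tM.
by move: xt; rewrite (xi_at _ nt) 1?ltnW//; exact: upM.
Qed.

Lemma alphaE (k : nat) : alpha l s g k =
  (\sum_(n < M | state_of (conf l s g n) == k) holding (conf l s g n))%:E.
Proof.
rewrite /alpha busy_endE -(occupation k (leqnSn M)).2.
by congr (lebesgue_measure _); apply/seteqP; split=> t /=; rewrite lte_fin.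
Qed.

End Cycles.

Section Busy_period.
Variables (R : realType) (l s g : nat -> R).
Hypotheses (l_gt0 : forall n, 0 < l n) (s_gt0 : forall n, 0 < s n)
  (g_gt0 : forall n, 0 < g n).

Local Notation oplife0 := (oplife0 l s g).
Local Notation oplife1 := (oplife1 l s g).
Local Notation alive := (alive l s g).

Lemma oplife1_gt0 j : 0 < oplife1 j.
Proof. by rewrite oplife1E /residual; case: ifP; rewrite ?subr_gt0. Qed.

Lemma oplife0_gt0 j : alive j -> 0 < oplife0 j.
Proof. by case: j => //= j /andP[_]; rewrite subr_gt0. Qed.

Variable j : nat.
Hypotheses (aj : alive j) (xg : oplife1 j < g j.*2.+1).

Lemma state_cycle i : (i <= j)%N ->
  state_of (conf l s g i.*2) = 0%N /\ state_of (conf l s g i.*2.+1) = 1%N.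
Proof. by move=> ij; have [-> ->] := conf_cycle (alive_le ij aj). Qed.

Lemma holding_cycle i : (i <= j)%N ->
  holding (conf l s g i.*2) = stay0 l s g i /\
  holding (conf l s g i.*2.+1) = stay1 l s g i.
Proof. by move=> ij; have [-> ->] := conf_cycle (alive_le ij aj). Qed.

Lemma stay_gt0 i : (i <= j)%N -> 0 < stay0 l s g i /\ 0 < stay1 l s g i.
Proof.
move=> ij; rewrite /stay0 /stay1 !lt_min s_gt0 g_gt0 oplife1_gt0 oplife0_gt0//.
exact: alive_le ij aj.
Qed.

Lemma lt_doubleP n : (n < j.+1.*2)%N ->
  exists2 i, (i <= j)%N & n = i.*2 \/ n = i.*2.+1.
Proof.
move=> nj; exists n./2.
  by rewrite -ltnS -ltn_double (leq_ltn_trans _ nj)// -{2}(odd_double_half n) leq_addl.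
by rewrite -{1 3}(odd_double_half n); case: (odd n); [right|left].
Qed.

(** A repair that outlasts the operating life of cycle j, without a tie, leads to
    a state 2 of positive duration, at which the busy period ends. *)
Lemma alpha_cycles (k : nat) : (k < 2)%N -> alpha l s g k =
  (acc l s g (fun m n => if k == 0%N then m else n) j.+1)%:E.
Proof.
move=> k2; rewrite (@alphaE _ _ _ _ j.+1.*2); first last.
- move=> n /lt_doubleP[i ij [->|->]].
    by rewrite (state_cycle ij).1.
  by rewrite (state_cycle ij).2.
- by rewrite (conf_down aj) ?ltW.
- move=> n; rewrite leq_eqVlt => /predU1P[->|/lt_doubleP[i ij [->|->]]].
  + by rewrite (conf_down aj) ?ltW//= subr_gt0.
  + by rewrite (holding_cycle ij).1 (stay_gt0 ij).1.
  + by rewrite (holding_cycle ij).2 (stay_gt0 ij).2.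
congr EFin; rewrite /acc.
suff H i : (i <= j.+1)%N ->
    \sum_(n < i.*2 | state_of (conf l s g n) == k) holding (conf l s g n) =
    \sum_(n < i) (if k == 0%N then stay0 l s g n else stay1 l s g n) by exact: H.
elim: i => [|i IH] ij; first by rewrite !big_ord0.
have [h0 h1] := holding_cycle ij; have [t0 t1] := state_cycle ij.
rewrite big_ord_recr -(IH (ltnW ij)) doubleS.
rewrite (@sum_ord_recr_cond _ i.*2.+1 (fun n => state_of (conf l s g n) == k)
  (fun n => holding (conf l s g n))).
rewrite (@sum_ord_recr_cond _ i.*2 (fun n => state_of (conf l s g n) == k)
  (fun n => holding (conf l s g n))).
rewrite -addrA h0 h1 t0 t1; congr (_ + _).
by case: k k2 {IH} => [|[|]]//= _; rewrite ?addr0 ?add0r.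
Qed.

End Busy_period.

(** * Measurability of the occupation times *)

Section Measurability.
Context (d : measure_display) (T : measurableType d) (R : realType).
Variables l s g : nat -> T -> R.
Hypotheses (ml : forall n, measurable_fun setT (l n))
  (ms : forall n, measurable_fun setT (s n))
  (mg : forall n, measurable_fun setT (g n)).

Local Notation path F w := (F (fun n => l n w) (fun n => s n w) (fun n => g n w)).

(** The type of configurations carries no sigma-algebra; a configuration is
    encoded by its state and two clocks, the second one being 0 in state 2. *)
Definition clock1 (c : config R) : R :=
  match c with Both x _ => x | One x _ => x | Down r => r end.

Definition clock2 (c : config R) : R :=
  match c with Both _ y => y | One _ r => r | Down _ => 0 end.

Let st n w := state_of (path (@conf R) w n).
Let c1 n w := clock1 (path (@conf R) w n).
Let c2 n w := clock2 (path (@conf R) w n).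

Let stS n w : st n.+1 w = if st n w == 0%N then 1%N else
  if st n w == 1%N then (if c2 n w < c1 n w then 0%N else 2%N) else 1%N.
Proof.
by rewrite /st /c1 /c2 /=; case: (path (@conf R) w n) => //= x y; case: ifP.
Qed.

Let c1S n w : c1 n.+1 w =
  if st n w == 0%N then (if c2 n w < c1 n w then c1 n w - c2 n w else l n.+1 w)
  else if st n w == 1%N then
    (if c2 n w < c1 n w then c1 n w - c2 n w else c2 n w - c1 n w)
  else l n.+1 w.
Proof.
by rewrite /st /c1 /c2 /=; case: (path (@conf R) w n) => //= x y; case: ifP.
Qed.

Let c2S n w : c2 n.+1 w =
  if st n w == 0%N then g n.+1 w
  else if st n w == 1%N then (if c2 n w < c1 n w then s n.+1 w else 0)
  else g n.+1 w.
Proof.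
by rewrite /st /c1 /c2 /=; case: (path (@conf R) w n) => //= x y; case: ifP.
Qed.

Let holdingE n w : holding (path (@conf R) w n) =
  if (st n w < 2)%N then Num.min (c1 n w) (c2 n w) else c1 n w.
Proof. by rewrite /st /c1 /c2; case: (path (@conf R) w n). Qed.

Let mnat (f : nat -> bool) (h : T -> nat) : measurable_fun setT h ->
  measurable_fun setT (fun w => f (h w)).
Proof. by move=> mh; apply: (measurableT_comp _ mh). Qed.

Let measurable_conf n : [/\ measurable_fun setT (st n),
  measurable_fun setT (c1 n) & measurable_fun setT (c2 n)].
Proof.
elim: n => [|n [mst mc1 mc2]].
  split; [exact: measurable_cst|exact: ml|exact: ms].
have m0 := mnat (fun k => k == 0%N) mst.
have m1 := mnat (fun k => k == 1%N) mst.
have m12 : measurable_fun setT (fun w => c2 n w < c1 n w).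
  exact: measurable_fun_ltr.
split.
- rewrite (_ : st n.+1 = fun w => if st n w == 0%N then 1%N else
    if st n w == 1%N then (if c2 n w < c1 n w then 0%N else 2%N) else 1%N).
    by do 3 (apply: measurable_fun_ifT => //).
  by apply/funext => w; rewrite stS.
- rewrite (_ : c1 n.+1 = fun w =>
    if st n w == 0%N then (if c2 n w < c1 n w then c1 n w - c2 n w else l n.+1 w)
    else if st n w == 1%N then
      (if c2 n w < c1 n w then c1 n w - c2 n w else c2 n w - c1 n w)
    else l n.+1 w); last by apply/funext => w; rewrite c1S.
  apply: measurable_fun_ifT => //.
    by apply: measurable_fun_ifT => //; exact: measurable_funB.
  apply: measurable_fun_ifT => //.
  by apply: measurable_fun_ifT => //; exact: measurable_funB.
- rewrite (_ : c2 n.+1 = fun w => if st n w == 0%N then g n.+1 w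
    else if st n w == 1%N then (if c2 n w < c1 n w then s n.+1 w else 0)
    else g n.+1 w); last by apply/funext => w; rewrite c2S.
  by do 3 (apply: measurable_fun_ifT => //).
Qed.

Lemma measurable_epoch n : measurable_fun setT (fun w => path (@epoch R) w n).
Proof.
apply: measurable_sum => i; under eq_fun do rewrite holdingE.
have [mst mc1 mc2] := measurable_conf i.
apply: measurable_fun_ifT => //; first exact: (mnat (fun k => (k < 2)%N)).
exact: measurable_minr.
Qed.

Definition jumps_spec (w : T) (t : R) (n : nat) : Prop :=
  t < path (@epoch R) w n.+1 /\ forall m, (m < n)%N -> path (@epoch R) w m.+1 <= t.

Lemma jumps_unique w t n : jumps_spec w t n -> path (@jumps R) w t = n.
Proof.
move=> [tn nt]; apply: xget_unique => // k [tk kt].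
case: (ltngtP k n) => // [kn|nk].
- by have := lt_le_trans tk (nt _ kn); rewrite ltxx.
- by have := lt_le_trans tn (kt _ nk); rewrite ltxx.
Qed.

Let Rb := measurableTypeR R.

Let mE n : measurable_fun setT (fun p : T * Rb => path (@epoch R) p.1 n).
Proof. exact: (measurableT_comp (measurable_epoch n) measurable_fst). Qed.

Let m2 : measurable_fun setT (fun p : T * Rb => p.2 : R).
Proof. exact: measurable_snd. Qed.

Let mset_bool (d' : measure_display) (T' : measurableType d') (b : T' -> bool) :
  measurable_fun setT b -> measurable [set w | b w].
Proof.
move=> mb; rewrite [X in measurable X](_ : _ = b @^-1` [set true])//.
by rewrite -[_ @^-1` _]setTI; exact: mb.
Qed.

Let measurable_jumps_spec n : measurable [set p : T * Rb | jumps_spec p.1 p.2 n].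
Proof.
rewrite (_ : [set _ | _] = [set p | p.2 < path (@epoch R) p.1 n.+1] `&`
  \bigcap_(m in [set m | (m < n)%N]) [set p | path (@epoch R) p.1 m.+1 <= p.2]).
  apply: measurableI; first exact/mset_bool/measurable_fun_ltr.
  by apply: bigcap_measurableType => m _; exact/mset_bool/measurable_fun_ler.
by apply/seteqP; split.
Qed.

Let measurable_jumps n : measurable [set p : T * Rb | path (@jumps R) p.1 p.2 = n].
Proof.
rewrite (_ : [set _ | _] = [set p | jumps_spec p.1 p.2 n] `|`
  (if n == 0%N then ~` (\bigcup_m [set p | jumps_spec p.1 p.2 m]) else set0)).
  apply: measurableU => //; case: ifP => // _.
  by apply: measurableC; exact: bigcupT_measurable.
apply/seteqP; split=> [p /= <-|p /= [/jumps_unique//|]].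
  rewrite /jumps; case: xgetP => [k _ pk|]; first by left.
  by move=> N; right=> /= -[m _ /N].
case: eqP => // -> H; apply: xgetPN => m pm; apply: H; by exists m.
Qed.

(** Joint measurability in outcome and time, so that occupation times are
    measurable as the Lebesgue measures of sections. *)
Lemma measurable_xi k : measurable [set p : T * Rb | path (@xi R) p.1 p.2 = k].
Proof.
rewrite (_ : [set _ | _] = \bigcup_n
  ([set p | path (@jumps R) p.1 p.2 = n] `&` [set p | st n p.1 == k])).
  apply: bigcupT_measurable => n; apply: measurableI => //; apply: mset_bool.
  have [mst _ _] := measurable_conf n.
  exact: (measurableT_comp (mnat (fun i => i == k) mst) measurable_fst).
apply/seteqP; split=> [p /= <-|p [n _ [/= <- /eqP]]] //.
by exists (path (@jumps R) p.1 p.2) => //; split=> //=.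
Qed.

(** Right-continuity in states 1 and 2: there the number of jumps is not the
    default value used after an accumulation of jumps, so the next epoch lies
    beyond t. *)
Lemma xi_right w t : path (@xi R) w t <> 0%N -> exists2 e, t < e &
  forall t', t <= t' < e -> path (@xi R) w t' = path (@xi R) w t.
Proof.
rewrite /xi /jumps; case: xgetP => [n _ tn _|//].
case: (tn) => tn1 tn2; exists (path (@epoch R) w n.+1) => // t' /andP[tt' t'n].
suff /jumps_unique : jumps_spec w t' n by rewrite /jumps => ->.
by split=> // m mn; apply: le_trans tt'; exact: tn2.
Qed.

(** By right-continuity the infimum may be taken over rational times in state 2. *)
Lemma measurable_busy_end : measurable_fun setT (fun w => path (@busy_end R) w).
Proof.
move=> mT; apply: (measurability _ (ErealGenInftyO.measurableE R)) => //.
move=> _ [_ [r ->] <-]; rewrite setTI.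
rewrite (_ : _ @^-1` _ = \bigcup_q [set w | [/\ 0 <= (ratr q : R),
    (ratr q : R) < r & path (@xi R) w (ratr q) = 2%N]]).
  apply: bigcupT_measurable_rat => q.
  have [q0|q0] := boolP ((0 <= (ratr q : R)) && ((ratr q : R) < r)); last first.
    rewrite (_ : [set _ | _] = set0)// -subset0 => w [q1 q2 _].
    by rewrite q1 q2 in q0.
  rewrite (_ : [set _ | _] = (fun w => (w, ratr q : Rb)) @^-1`
      [set p : T * Rb | path (@xi R) p.1 p.2 = 2%N]).
    rewrite -[_ @^-1` _]setTI; apply: measurable_fun_pair => //.
    exact: measurable_xi.
  by have [q1 q2] := andP q0; apply/seteqP; split=> w /=; [case|].
apply/seteqP; split=> [w /=|w [q _ [q0 qr xq]] /=]; rewrite in_itv/=.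
  move=> /ereal_inf_lt[_ [t [t0 xt] <-]]; rewrite lte_fin => tr.
  have [|e te xe] := @xi_right w t; first by rewrite xt.
  have /rat_in_itvoo[q] : t < Num.min e r by rewrite lt_min te.
  rewrite in_itv/= lt_min => /and3P[tq qe qr].
  exists q => //; split=> //; first exact: (le_trans t0 (ltW tq)).
  by rewrite xe ?xt// (ltW tq).
by apply: (@le_lt_trans _ _ (ratr q : R)%:E) => //; apply: ereal_inf_lbound;
  exists (ratr q : R).
Qed.

Lemma measurable_alpha k :
  measurable_fun setT (fun w => path (@alpha R) w k).
Proof.
pose A := [set p : T * Rb | 0 <= p.2] `&`
  ([set p : T * Rb | (p.2%:E < path (@busy_end R) p.1)%E] `&`
   [set p : T * Rb | path (@xi R) p.1 p.2 = k]).
have mA : measurable A.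
  apply: measurableI; first by apply/mset_bool/measurable_fun_ler.
  apply: measurableI; last exact: measurable_xi.
  apply/mset_bool/measurable_fun_lte; first exact/measurable_EFinP.
  exact: (measurableT_comp measurable_busy_end measurable_fst).
have := measurable_fun_xsection (@lebesgue_measure R) mA.
rewrite (_ : _ \o _ = fun w => path (@alpha R) w k)//.
apply/funext => w; rewrite /= /alpha; congr (lebesgue_measure _).
by rewrite xsectionE.
Qed.

End Measurability.

(** * Memoryless laws *)

(* Measurability of functions built from projections, arithmetic, comparisons,
   conditionals and functions known to be measurable; the goal is inspected
   syntactically since unification would unfold minima into conditionals. *)
Ltac mfun := repeat (first
  [ assumption
  | exact: measurable_id | exact: measurable_cst
  | exact: measurable_fst | exact: measurable_snd
  | lazymatch goal with
    | |- measurable_fun _ (fun x => (@?f x, @?g x)) =>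
        apply: (measurable_fun_pair (f := f) (g := g))
    | |- measurable_fun _ (fun x => Order.min (@?f x) (@?g x)) =>
        apply: (measurable_minr (f := f) (g := g))
    | |- measurable_fun _ (fun x => Order.lt (@?f x) (@?g x)) => apply: measurable_fun_ltr
    | |- measurable_fun _ (Order.lt _) => apply: measurable_fun_ltr
    | |- measurable_fun _ (fun x => Order.le (@?f x) (@?g x)) => apply: measurable_fun_ler
    | |- measurable_fun _ (fun x => (@?f x - @?g x)%R) =>
        apply: (measurable_funB (f := f) (g := g))
    | |- measurable_fun _ (fun x => (@?f x + @?g x)%R) =>
        apply: (measurable_funD (f := f) (g := g))
    | |- measurable_fun _ (fun x => (@?f x)%:E) =>
        apply/(measurable_EFinP _ f)
    | |- measurable_fun _ (fun x => fst (@?f x)) =>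
        apply: (measurableT_comp (g := f) measurable_fst)
    | |- measurable_fun _ (fun x => snd (@?f x)) =>
        apply: (measurableT_comp (g := f) measurable_snd)
    | H : measurable_fun _ ?h |- measurable_fun _ (fun x => ?h (@?f x)) =>
        apply: (measurableT_comp (g := f) H)
    | _ => apply: measurable_fun_ifT
    end ]).

Section Uniqueness.
Context (R : realType).

Lemma measure_unique_rays (m1 m2 : {measure set R -> \bar R}) :
  (forall x, m1 `]x, +oo[%classic = m2 `]x, +oo[%classic) ->
  (forall x, (m1 `]x, +oo[%classic < +oo)%E) ->
  forall A, measurable A -> m1 A = m2 A.
Proof.
move=> m12 m1oo A mA.
apply: (@measure_unique _ R R (@RGenOInfty.G R)
  (fun n : nat => `](- n%:R : R), +oo[%classic) _ _ _ _ m1 m2) => //.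
- exact: RGenOInfty.measurableE.
- move=> _ _ [x ->] [y ->]; exists (Num.max x y).
  by apply/seteqP; split=> z /=; rewrite !in_itv/= !andbT gt_max => /andP.
- by move=> n; exists (- n%:R).
- apply/seteqP; split=> // x _; exists (Num.truncn `|x|).+1 => //=.
  rewrite in_itv/= andbT ltrNl (le_lt_trans (ler_norm (- x)))//.
  by rewrite normrN Num.Theory.truncnS_gt.
- by move=> _ [x ->].
Qed.

Lemma measure_unique_rays_lt (m1 m2 : {measure set R -> \bar R}) :
  (forall x, m1 `]-oo, x[%classic = m2 `]-oo, x[%classic) ->
  (forall x, (m1 `]-oo, x[%classic < +oo)%E) ->
  forall A, measurable A -> m1 A = m2 A.
Proof.
move=> m12 m1oo A mA.
apply: (@measure_unique _ R R (@RGenInftyO.G R)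
  (fun n : nat => `]-oo, (n%:R : R)[%classic) _ _ _ _ m1 m2) => //.
- exact: RGenInftyO.measurableE.
- move=> _ _ [x ->] [y ->]; exists (Num.min x y).
  by apply/seteqP; split=> z /=; rewrite !in_itv/= lt_min => /andP.
- by move=> n; exists n%:R.
- apply/seteqP; split=> // x _; exists (Num.truncn `|x|).+1 => //=.
  by rewrite in_itv/= (le_lt_trans (ler_norm x))// Num.Theory.truncnS_gt.
- by move=> _ [x ->].
Qed.

Lemma measure_unique_prod (d1 d2 : measure_display) (T1 : measurableType d1)
    (T2 : measurableType d2) (m1 m2 : {measure set (T1 * T2) -> \bar R}) :
  (forall A B, measurable A -> measurable B -> m1 (A `*` B) = m2 (A `*` B)) ->
  (m1 setT < +oo)%E ->
  forall A, measurable A -> m1 A = m2 A.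
Proof.
move=> m12 m1oo.
pose C : set (set (T1 * T2)) :=
  [set C | exists A, measurable A /\ exists B, measurable B /\ C = A `*` B].
have CI : setI_closed C.
  move=> /= _ _ [X1 [mX1 [X2 [mX2 ->]]]] [Y1 [mY1 [Y2 [mY2 ->]]]].
  rewrite -setXI; exists (X1 `&` Y1); split; first exact: measurableI.
  by exists (X2 `&` Y2); split => //; exact: measurableI.
move=> A mA; apply: (measure_unique C (fun=> setT)) => //.
- rewrite measurable_prod_measurableType //; congr (<<s _ >>).
  rewrite predeqE; split => [[X mX [Y mY <-]]|[X [mX [Y [mY ->]]]]].
    by exists X; split => //; exists Y.
  by exists X => //; exists Y.
- by move=> n; exists setT; split=> //; exists setT; split=> //; rewrite setXTT.
- by rewrite bigcup_const.
- by move=> _ [X [mX [Y [mY ->]]]]; exact: m12.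
Qed.

End Uniqueness.

Section Exponential.
Context (R : realType).
Implicit Types (E : probability R R).
Local Open Scope ereal_scope.

(** The survival function determines the law, and its multiplicativity is
    memorylessness. *)
Definition exp_law (rate : R) E :=
  forall x : R, (0 <= x)%R -> E `]x, +oo[%classic = (expR (- rate * x))%:E.

Definition positive_law E := E `]-oo, 0%R]%classic = 0.

Lemma exp_law_positive rate E : exp_law rate E -> positive_law E.
Proof.
move=> HE; rewrite /positive_law -setCitvr probability_setC// HE//.
by rewrite mulr0 expR0 subee.
Qed.

Lemma positive_law_ray E x : positive_law E -> (x <= 0)%R ->
  E `]x, +oo[%classic = 1.
Proof.
move=> E0 x0; rewrite -setCitvl probability_setC//.
rewrite (_ : E _ = 0) ?sube0//; apply: subset_measure0 E0 => //.
by move=> y /=; rewrite !in_itv/= => /le_trans; apply.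
Qed.

Lemma positive_law_eq_integral E (f g : R -> \bar R) : positive_law E ->
  measurable_fun setT f -> measurable_fun setT g ->
  (forall x, 0 <= f x) -> (forall x, 0 <= g x) ->
  (forall x, (0 < x)%R -> f x = g x) ->
  \int[E]_x f x = \int[E]_x g x.
Proof.
move=> E0 mf mg f0 g0 fg.
rewrite (@ge0_negligible_integral _ _ _ E setT `]-oo, 0%R]%classic)//.
rewrite [RHS](@ge0_negligible_integral _ _ _ E setT `]-oo, 0%R]%classic)//.
apply: eq_integral => x; rewrite inE => -[_ /=]; rewrite in_itv/= => /negP.
by rewrite -ltNge => /fg.
Qed.

Lemma eq_integral_above E (s : R) (f g : R -> \bar R) :
  measurable_fun setT f -> measurable_fun setT g ->
  (forall x, 0 <= f x) -> (forall x, 0 <= g x) ->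
  (forall x, (x <= s)%R -> f x = g x) ->
  \int[E]_(x in `]s, +oo[) f x = \int[E]_(x in `]s, +oo[) g x ->
  \int[E]_x f x = \int[E]_x g x.
Proof.
move=> mf mg f0 g0 fg fg'.
have split (h : R -> \bar R) : measurable_fun setT h -> (forall x, 0 <= h x) ->
    \int[E]_x h x = \int[E]_(x in `]-oo, s]) h x + \int[E]_(x in `]s, +oo[) h x.
  move=> mh h0; rewrite -ge0_integral_setU//.
  - by rewrite -setCitvr setvU.
  - exact: measurable_funS mh.
  - by rewrite -setCitvr disj_set2E setICl.
rewrite (split f)// (split g)// fg'; congr (_ + _).
by apply: eq_integral => x; rewrite inE/= in_itv/=; exact: fg.
Qed.

(** The law of x - s on the event s < x and the multiple of E agree on rays. *)
Lemma memoryless rate E (s : R) (f : R -> \bar R) : exp_law rate E -> (0 <= s)%R ->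
  measurable_fun setT f -> (forall x, 0 <= f x) ->
  \int[E]_(x in `]s, +oo[) f (x - s)%R = E `]s, +oo[%classic * \int[E]_x f x.
Proof.
move=> HE s0 mf f0.
have sE : E `]s, +oo[%classic = (expR (- rate * s))%:E by exact: HE.
have E0 := exp_law_positive HE.
pose sub (x : R) : R := (x - s)%R.
have msub : measurable_fun setT sub by rewrite /sub; mfun.
have mD : measurable (`]0%R, +oo[%classic : set R) by [].
have preE (x : R) : sub @^-1` `]x, +oo[ = `](x + s)%R, +oo[%classic.
  by apply/seteqP; split=> y /=; rewrite /sub !in_itv/= !andbT ltrBrDr.
pose X : {mfun R >-> R} :=
  HB.pack sub (isMeasurableFun.Build _ _ _ _ sub msub).
transitivity (\int[distribution E X]_(y in `]0%R, +oo[) f y).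
  rewrite ge0_integral_pushforward//.
  - by rewrite preE add0r.
  - exact: measurable_funS mf.
pose k : {nonneg R} := NngNum (expR_ge0 (- rate * s)).
rewrite (eq_measure_integral (mscale k E)); last first.
  move=> A mA /setIidl <-.
  apply: (@measure_unique_rays _ (mrestr (distribution E X) mD)
    (mrestr (mscale k E) mD)) => //= x; last first.
    by rewrite /mrestr ltey_eq fin_num_measure//; exact: measurableI.
  have m0 : (0 <= Num.max x 0)%R by rewrite le_max lexx orbT.
  rewrite /mrestr /distribution /pushforward /mscale /=.
  rewrite (_ : _ `&` _ = `](Num.max x 0)%R, +oo[%classic); last first.
    by apply/seteqP; split=> y /=; rewrite !in_itv/= !andbT gt_max => /andP.
  rewrite preE !HE ?addr_ge0//.
  by rewrite -EFinM -expRD -mulrDr addrC.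
rewrite ge0_integral_mscale//; last exact: measurable_funS mf.
congr (_ * _); first by rewrite /= sE.
rewrite [RHS](@ge0_negligible_integral _ _ _ E setT `]-oo, 0%R]%classic)//.
by rewrite setTD setCitvl.
Qed.

(** Given that the life exceeds r, its overshoot over r is a fresh life; on the
    complementary event both integrands are k. *)
Lemma overshoot rate E (r : R) (f k : R -> \bar R) : exp_law rate E ->
  (0 <= r)%R ->
  measurable_fun setT f -> (forall x, 0 <= f x) ->
  measurable_fun setT k -> (forall x, 0 <= k x) ->
  \int[E]_x (if (r < x)%R then f (x - r)%R else k x) =
  \int[E]_x (if (r < x)%R then \int[E]_z f z else k x).
Proof.
move=> HE r0 mf f0 mk k0.
have I0 : 0 <= \int[E]_z f z by exact: integral_ge0.
have if0 (b : bool) (x y : \bar R) : 0 <= x -> 0 <= y ->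
  0 <= (if b then x else y) by case: b.
apply: (eq_integral_above (s := r)).
- by mfun.
- by mfun.
- by move=> x; exact: if0.
- by move=> x; exact: if0.
- by move=> x; rewrite leNgt => /negbTE ->.
transitivity (\int[E]_(x in `]r, +oo[) f (x - r)%R).
  by apply: eq_integral => x; rewrite inE/= in_itv/= andbT => ->.
rewrite (memoryless HE)//.
transitivity (\int[E]_(x in `]r, +oo[) cst (\int[E]_z f z) x); last first.
  by apply: eq_integral => x; rewrite inE/= in_itv/= andbT => ->.
by rewrite integral_cst// muleC.
Qed.

(** [overshoot] integrated over a positive random r. *)
Lemma overshoot_fresh rate E E' (h k : R * R -> \bar R) : exp_law rate E ->
  positive_law E' -> measurable_fun setT h -> (forall z, 0 <= h z) ->
  measurable_fun setT k -> (forall z, 0 <= k z) ->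
  \int[E]_l \int[E']_r (if (r < l)%R then h (r, l - r)%R else k (l, r)) =
  \int[E]_l \int[E']_r (if (r < l)%R then \int[E]_z h (r, z) else k (l, r)).
Proof.
move=> HE E'0 mh h0 mk k0.
have I0 r : 0 <= \int[E]_z h (r, z) by exact: integral_ge0.
have mI := measurable_fun_fubini_tonelli_F (m2 := E) h mh h0.
have if0 (b : bool) (x y : \bar R) : 0 <= x -> 0 <= y ->
  0 <= (if b then x else y) by case: b.
pose f1 (p : R * R) := if (p.2 < p.1)%R then h (p.2, p.1 - p.2)%R else k (p.1, p.2).
pose f2 (p : R * R) := if (p.2 < p.1)%R then \int[E]_z h (p.2, z) else k (p.1, p.2).
have mf1 : measurable_fun setT f1 by rewrite /f1; mfun.
have mf2 : measurable_fun setT f2.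
  by rewrite /f2; mfun; exact: (measurableT_comp mI measurable_snd).
have f10 p : 0 <= f1 p by exact: if0.
have f20 p : 0 <= f2 p by exact: if0.
transitivity (\int[E]_l \int[E']_r f1 (l, r)).
  by apply: eq_integral => l _; apply: eq_integral.
transitivity (\int[E]_l \int[E']_r f2 (l, r)); last first.
  by apply: eq_integral => l _; apply: eq_integral.
rewrite (fubini_tonelli (m1 := E) (m2 := E') f1 mf1 f10).
rewrite (fubini_tonelli (m1 := E) (m2 := E') f2 mf2 f20).
apply: (positive_law_eq_integral (f := fun r => \int[E]_l f1 (l, r))
  (g := fun r => \int[E]_l f2 (l, r)) E'0).
- exact: (measurable_fun_fubini_tonelli_G (m1 := E) f1 mf1 f10).
- exact: (measurable_fun_fubini_tonelli_G (m1 := E) f2 mf2 f20).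
- by move=> r; exact: integral_ge0.
- by move=> r; exact: integral_ge0.
- move=> r r0; apply: (overshoot (f := fun z => h (r, z)) (k := fun l => k (l, r))
    HE (ltW r0)) => //.
  + exact: measurable_fun_pair2.
  + exact: measurable_fun_pair1.
Qed.

Lemma residual_fresh_at rate E (y : R) (h : R * R -> \bar R) : exp_law rate E ->
  (0 <= y)%R -> measurable_fun setT h -> (forall z, 0 <= h z) ->
  \int[E]_x \int[E]_z
     h (Num.min x y, if (y < x)%R then (x - y)%R else z) =
  \int[E]_x \int[E]_z h (Num.min x y, z).
Proof.
move=> HE y0 mh h0.
pose k1 (p : R * R) :=
  h (Num.min p.1 y, if (y < p.1)%R then (p.1 - y)%R else p.2).
pose k2 (p : R * R) := h (Num.min p.1 y, p.2).
have mk1 : measurable_fun setT k1 by rewrite /k1; mfun.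
have mk2 : measurable_fun setT k2 by rewrite /k2; mfun.
have k10 p : 0 <= k1 p by exact: h0.
have k20 p : 0 <= k2 p by exact: h0.
have mhy : measurable_fun setT (fun z => h (y, z)) by exact: measurable_fun_pair2.
have I0 : 0 <= \int[E]_z h (y, z) by exact: integral_ge0.
apply: (eq_integral_above (s := y) (f := fun x => \int[E]_z k1 (x, z))
  (g := fun x => \int[E]_z k2 (x, z))).
- exact: (measurable_fun_fubini_tonelli_F k1 mk1 k10).
- exact: (measurable_fun_fubini_tonelli_F k2 mk2 k20).
- by move=> x; exact: integral_ge0.
- by move=> x; exact: integral_ge0.
- by move=> x; rewrite leNgt => /negbTE xy; apply: eq_integral => z _;
    rewrite /k1 /k2 /= xy.
transitivity (\int[E]_(x in `]y, +oo[) h (y, x - y)%R).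
  apply: eq_integral => x; rewrite inE/= in_itv/= andbT => xy.
  rewrite /k1 /= xy (min_idPr (ltW xy)) integral_cst//.
  by rewrite [X in _ * X](@probability_setT _ _ _ E) mule1.
rewrite (memoryless (f := fun x => h (y, x)) HE y0)//.
transitivity (\int[E]_(x in `]y, +oo[) cst (\int[E]_z h (y, z)) x).
  by rewrite integral_cst// muleC.
apply: eq_integral => x; rewrite inE/= in_itv/= andbT => xy.
by rewrite /k2 /= (min_idPr (ltW xy)).
Qed.

(** After the first failure of the pair, the good unit has a fresh residual
    life: if the standby unit failed, the overshoot is fresh; otherwise a
    fresh life is put into operation. *)
Lemma residual_fresh rate E E' (h : R * R -> \bar R) : exp_law rate E ->
  positive_law E' -> measurable_fun setT h -> (forall z, 0 <= h z) ->
  \int[E]_x \int[E']_y \int[E]_z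
     h (Num.min x y, if (y < x)%R then (x - y)%R else z) =
  \int[E]_x \int[E']_y \int[E]_z h (Num.min x y, z).
Proof.
move=> HE E'0 mh h0.
pose k1 (p : (R * R) * R) :=
  h (Num.min p.1.1 p.1.2, if (p.1.2 < p.1.1)%R then (p.1.1 - p.1.2)%R else p.2).
pose k2 (p : (R * R) * R) := h (Num.min p.1.1 p.1.2, p.2).
have mk1 : measurable_fun setT k1 by rewrite /k1; mfun.
have mk2 : measurable_fun setT k2 by rewrite /k2; mfun.
have k10 p : 0 <= k1 p by exact: h0.
have k20 p : 0 <= k2 p by exact: h0.
pose f1 (p : R * R) := \int[E]_z k1 (p, z).
pose f2 (p : R * R) := \int[E]_z k2 (p, z).
have mf1 : measurable_fun setT f1 := measurable_fun_fubini_tonelli_F k1 mk1 k10.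
have mf2 : measurable_fun setT f2 := measurable_fun_fubini_tonelli_F k2 mk2 k20.
have f10 p : 0 <= f1 p by exact: integral_ge0.
have f20 p : 0 <= f2 p by exact: integral_ge0.
transitivity (\int[E]_x \int[E']_y f1 (x, y)).
  by apply: eq_integral => x _; apply: eq_integral.
transitivity (\int[E]_x \int[E']_y f2 (x, y)); last first.
  by apply: eq_integral => x _; apply: eq_integral.
rewrite (fubini_tonelli (m1 := E) (m2 := E') f1 mf1 f10).
rewrite (fubini_tonelli (m1 := E) (m2 := E') f2 mf2 f20).
apply: (positive_law_eq_integral (f := fun y => \int[E]_x f1 (x, y))
  (g := fun y => \int[E]_x f2 (x, y)) E'0).
- exact: (measurable_fun_fubini_tonelli_G (m1 := E) f1 mf1 f10).
- exact: (measurable_fun_fubini_tonelli_G (m1 := E) f2 mf2 f20).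
- by move=> r; exact: integral_ge0.
- by move=> r; exact: integral_ge0.
- by move=> y y0; exact: (residual_fresh_at HE (ltW y0) mh h0).
Qed.

End Exponential.

(** * Balance equations *)

Section Race.
Context (R : realType).
Implicit Types (E : probability R R).
Local Open Scope ereal_scope.

Lemma probability_rayE E (t : R) :
  E `]t, +oo[%classic = \int[E]_z (if (t < z)%R then 1 else 0).
Proof.
rewrite -[LHS]mul1e -integral_cst// integral_mkcond.
apply: eq_integral => z _; rewrite patchE.
by rewrite (_ : (z \in _) = (t < z)%R)// mem_setE in_itv/= andbT.
Qed.

(** The balance equation of state 1. By [overshoot_fresh] the fresh life in the
    first branch may be replaced by l - r, and then both branches test t < l. *)
Lemma race_balance rate E E' (t : R) : exp_law rate E -> positive_law E' ->
  \int[E]_l \int[E']_r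
    (if (r < l)%R then E `](t - Num.min l r)%R, +oo[%classic
     else if (t < Num.min l r)%R then 1 else 0) = E `]t, +oo[%classic.
Proof.
move=> HE E'0.
have if0 (b : bool) : 0 <= (if b then 1 else 0 : \bar R) by case: b.
pose h (p : R * R) : \bar R := if (t < p.1 + p.2)%R then 1 else 0.
pose k (p : R * R) : \bar R := if (t < p.1)%R then 1 else 0.
have mh : measurable_fun setT h by rewrite /h; mfun.
have mk : measurable_fun setT k by rewrite /k; mfun.
have := overshoot_fresh HE E'0 mh (fun p => if0 _) mk (fun p => if0 _).
rewrite /h /k /= => H.
transitivity (\int[E]_l \int[E']_r (if (r < l)%R then \int[E]_z
    (if (t < r + z)%R then 1 else 0) else if (t < l)%R then 1 else 0)).
  apply: eq_integral => l _; apply: eq_integral => r _.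
  have [rl|lr] := ltP r l; last by [].
  rewrite probability_rayE; apply: eq_integral => z _.
  by rewrite ltrBlDl.
rewrite -H probability_rayE.
apply: eq_integral => l _.
transitivity (\int[E']_r cst (if (t < l)%R then 1 else 0) r).
  by apply: eq_integral => r _; case: ifP => // _; rewrite addrC subrK.
by rewrite integral_cst// [X in _ * X](@probability_setT _ _ _ E') mule1.
Qed.

Lemma race_cst E E' (p A B : R) :
  \int[E]_l \int[E']_r (if (r < l)%R then 1 else 0) = p%:E ->
  (0 <= A)%R -> (0 <= B)%R ->
  \int[E]_l \int[E']_r (if (r < l)%R then A%:E else B%:E) =
  (p * A + (1 - p) * B)%:E.
Proof.
move=> pE A0 B0.
pose f x y (z : R * R) : \bar R := if (z.2 < z.1)%R then x else y.
have mf (x y : \bar R) : measurable_fun setT (f x y) by rewrite /f; mfun.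
have f0 (x y : \bar R) z : 0 <= x -> 0 <= y -> 0 <= f x y z.
  by move=> *; rewrite /f; case: ifP.
have fubini (x y : \bar R) : 0 <= x -> 0 <= y ->
    \int[E]_l \int[E']_r (if (r < l)%R then x else y) = \int[E \x E']_z f x y z.
  by move=> x0 y0; rewrite (fubini_tonelli1 (f x y) (mf x y))// => z; exact: f0.
move: pE; rewrite !fubini ?lee_fin// => pE.
have qE : \int[E \x E']_z f 0 1 z = (1 - p)%:E.
  have : \int[E \x E']_z f 1 1 z = 1.
    rewrite -fubini//; transitivity (\int[E]_l cst (1 : \bar R) l).
      apply: eq_integral => l _; transitivity (\int[E']_r cst (1 : \bar R) r).
        by apply: eq_integral => r _; case: ifP.
      by rewrite integral_cst// [X in _ * X](@probability_setT _ _ _ E') mule1.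
    by rewrite integral_cst// [X in _ * X](@probability_setT _ _ _ E) mule1.
  have -> : f 1 1 = (fun z => f 1 0 z + f 0 1 z).
    by apply/funext => z; rewrite /f; case: ifP; rewrite ?adde0 ?add0e.
  rewrite ge0_integralD//; [|by move=> z _; exact: f0|by move=> z _; exact: f0].
  rewrite pE; case: (\int[_]_z f 0 1 z) => [r|//|//].
  by rewrite -EFinD => -[<-]; rewrite addrC addKr.
have -> : f A%:E B%:E = (fun z => A%:E * f 1 0 z + B%:E * f 0 1 z).
  by apply/funext => z; rewrite /f; case: ifP; rewrite ?mule0 ?mule1 ?adde0 ?add0e.
have fA z : 0 <= A%:E * f 1 0 z by rewrite mule_ge0 ?lee_fin//; exact: f0.
have fB z : 0 <= B%:E * f 0 1 z by rewrite mule_ge0 ?lee_fin//; exact: f0.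
rewrite ge0_integralD//; last 2 first.
- by apply: measurable_funeM.
- by apply: measurable_funeM.
rewrite !ge0_integralZl_EFin//; [|by move=> z _; exact: f0..].
by rewrite pE qE -!EFinM -EFinD mulrC [(B * _)%R]mulrC.
Qed.

Lemma race_prob01 E E'' (p : R) :
  \int[E]_z \int[E'']_r (if (r < z)%R then 1 else 0) = p%:E -> (0 <= p <= 1)%R.
Proof.
move=> pE.
rewrite -!lee_fin -pE; apply/andP; split.
  by apply: integral_ge0 => z _; apply: integral_ge0 => r _; case: ifP.
pose f (q : R * R) : \bar R := if (q.2 < q.1)%R then 1 else 0.
have mf : measurable_fun setT f by rewrite /f; mfun.
have f0 q : 0 <= f q by rewrite /f; case: ifP.
apply: (@le_trans _ _ (\int[E]_x cst 1 x)); last first.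
  by rewrite integral_cst// [X in _ * X](@probability_setT _ _ _ E) mule1.
apply: ge0_le_integral => //.
- by move=> z _; apply: integral_ge0 => r _; exact: (f0 (z, r)).
- exact: (measurable_fun_fubini_tonelli_F f mf f0).
move=> z _; apply: (@le_trans _ _ (\int[E'']_x cst 1 x)); last first.
  by rewrite integral_cst// [X in _ * X](@probability_setT _ _ _ E'') mule1.
apply: ge0_le_integral => //.
- by move=> r _; exact: (f0 (z, r)).
- by apply: (measurable_fun_pair2 (f := f)).
- by move=> r _ /=; case: ifP.
Qed.

End Race.

Section Mixture.
Context (R : realType).

Lemma integral_expR (m k a b : R) : 0 <= b ->
  (\int[lebesgue_measure]_(z in `[0%R, b]) (m * (k * expR (a + k * z)))%:E =
   (m * (expR (a + k * b) - expR a))%:E)%E.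
Proof.
rewrite le_eqVlt => /predU1P[<-|b0].
  by rewrite set_itv1 integral_set1 mulr0 addr0 subrr mulr0.
have dE (z : R) : is_derive z 1 (fun z => m * expR (a + k * z))
    (m * (k * expR (a + k * z))).
  apply: is_derive_eq.
  by rewrite /GRing.scale /=; ring.
have cF : continuous (fun z : R => m * expR (a + k * z)).
  move=> z; apply: differentiable_continuous; apply/derivable1_diffP.
  by apply: ex_derive.
have cf : continuous (fun z : R => m * (k * expR (a + k * z))).
  move=> z; apply: differentiable_continuous; apply/derivable1_diffP.
  by apply: ex_derive.
rewrite (continuous_FTC2 (F := fun z => m * expR (a + k * z)) b0).
- by rewrite -EFinB mulr0 addr0 mulrBr.
- exact: continuous_subspaceT.
- split=> [z _||].
  + by apply: ex_derive.
  + by apply: cvg_at_right_filter; exact: cF.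
  + by apply: cvg_at_left_filter; exact: cF.
- by move=> z _; rewrite derive1E; apply: derive_val.
Qed.

Local Open Scope ereal_scope.

(** If X is exponential with rate mu, then a sum of copies of X stopped after each
    term with probability 1 - p has tail exp(- c t) with c = mu (1 - p): the
    identity says that this tail is balanced over one term. The integral of the
    tail at t - X reduces, by Tonelli's theorem, to the survival function of X. *)
Lemma exp_thinning (d : measure_display) (O : measurableType d)
    (Q : probability O R) (X : O -> R) (mu p t : R) :
  measurable_fun setT X -> (0 < mu)%R -> (0 <= p <= 1)%R ->
  (forall m : R, (0 <= m)%R -> Q [set w | (m < X w)%R] = (expR (- mu * m))%:E) ->
  let c := (mu * (1 - p))%R in
  p%:E * \int[Q]_w (expR (- c * Num.max (t - X w) 0))%:E +
  (1 - p)%:E * Q [set w | (t < X w)%R] = (expR (- c * Num.max t 0))%:E.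
Proof.
move=> mX mu0 /andP[p0 p1] QX c.
have QT : Q setT = 1 := probability_setT Q.
have c0 : (0 <= c)%R by rewrite mulr_ge0 ?subr_ge0// ltW.
have q0 : (0 <= 1 - p)%R by rewrite subr_ge0.
have mB (m : R) : measurable [set w | (m < X w)%R].
  rewrite [X in measurable X](_ : _ = X @^-1` `]m, +oo[); last first.
    by apply/seteqP; split=> w /=; rewrite in_itv/= andbT.
  by rewrite -[_ @^-1` _]setTI; exact: mX.
pose N := [set w | ~ (0 < X w)%R].
have mN : measurable N by rewrite -[N]/(~` [set w | (0 < X w)%R]); exact: measurableC.
have Q1 : Q [set w | (0 < X w)%R] = 1 by rewrite (QX 0%R)// mulr0 expR0.
have QN : Q N = 0.
  have : Q setT = Q N + Q [set w | (0 < X w)%R].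
    by rewrite -measureU ?setICl// setvU.
  rewrite QT Q1; case: (Q N) => [r| |] // [r1]; congr EFin.
  by move: r1; lra.
have offN (f : O -> \bar R) : measurable_fun setT f -> (forall w, 0 <= f w) ->
    \int[Q]_w f w = \int[Q]_(w in ~` N) f w.
  move=> mf f0; rewrite (@ge0_negligible_integral _ _ _ Q setT N)//.
  by rewrite setTD.
pose u (w : O) := (expR (- c * Num.max (t - X w) 0))%:E : \bar R.
have mu_ : measurable_fun setT u.
  apply/measurable_EFinP; apply: measurableT_comp => //.
  apply: measurable_funM => //; apply: measurable_maxr => //.
  exact: measurable_funB.
have u0 w : 0 <= u w by rewrite lee_fin expR_ge0.
(* for t < 0 both sides are 1, as X is almost surely positive *)
rewrite offN//; have [t0|t0] := ltP t 0%R.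
  rewrite mulr0 expR0.
  transitivity (p%:E * \int[Q]_(w in ~` N) cst 1 w + (1 - p)%:E * 1).
    congr (_ * _ + _ * _).
      apply: eq_integral => w; rewrite inE => /contrapT Xw.
      by rewrite max_r ?mulr0 ?expR0// subr_le0 ltW// (lt_trans t0).
    apply/eqP; rewrite eq_le; apply/andP; split.
      by rewrite -QT; apply: le_measure; rewrite ?inE.
    rewrite [leLHS](_ : _ = Q [set w | (0 < X w)%R]).
      by apply: le_measure; rewrite ?inE// => w /=; exact: lt_trans.
    by rewrite (QX 0%R)// mulr0 expR0.
  rewrite integral_cst; last exact: measurableC.
  rewrite [X in 1 * X](_ : _ = 1) ?mule1; last first.
    rewrite -Q1; congr (Q _); apply/seteqP; split=> w /=; first exact: contrapT.
    by move=> X0; apply.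
  by rewrite -EFinD addrC subrK.
pose g (z : R) := (c * expR (- c * t + c * z))%R.
have g0 z : (0 <= g z)%R by rewrite mulr_ge0// expR_ge0.
pose F (q : O * measurableTypeR R) : \bar R :=
  if (0 <= q.2)%R then if (q.2 <= t)%R then
    if (q.2 < X q.1)%R then (g q.2)%:E else 0 else 0 else 0.
have F0 q : 0 <= F q by rewrite /F; do 3 case: ifP => // _; rewrite lee_fin.
have mg : measurable_fun setT (g : measurableTypeR R -> R).
  apply: measurable_funM => //; apply: measurableT_comp => //.
  by apply: measurable_funD => //; apply: measurable_funM.
have mF : measurable_fun setT F.
  rewrite /F.
  apply: measurable_fun_ifT => //; first by apply: measurable_fun_ler => //; mfun.
  apply: measurable_fun_ifT => //; first by apply: measurable_fun_ler => //; mfun.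
  apply: measurable_fun_ifT => //; first by apply: measurable_fun_ltr => //; mfun.
  exact/measurable_EFinP/(measurableT_comp mg).
(* for X > 0 the integrand is its value at X = 0 plus the integral of its
   derivative g over the z in [0, t] that lie below X *)
have uE w : (0 < X w)%R -> u w = (expR (- c * t))%:E +
    \int[lebesgue_measure]_z F (w, z).
  move=> X0; pose b := Num.min t (X w).
  have b0 : (0 <= b)%R by rewrite le_min t0 ltW.
  have -> : \int[lebesgue_measure]_z F (w, z) =
      \int[lebesgue_measure]_(z in `[0%R, b]) (1 * (c * expR (- c * t + c * z)))%:E.
    have [tX|Xt] := ltP t (X w).
      rewrite [RHS]integral_mkcond; apply: eq_integral => z _.
      rewrite patchE mem_setE in_itv/= /F /= /b (min_l (ltW tX)).
      case: (leP 0%R z) => //= _; case: (leP z t) => //= zt.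
      by rewrite (le_lt_trans zt tX) mul1r.
    transitivity (\int[lebesgue_measure]_(z in `[0%R, b[)
        (1 * (c * expR (- c * t + c * z)))%:E).
      rewrite [RHS]integral_mkcond; apply: eq_integral => z _.
      rewrite patchE mem_setE in_itv/= /F /= /b (min_r Xt).
      case: (leP 0%R z) => //= _; case: (leP z t) => [zt|tz].
        by rewrite mul1r.
      by rewrite [(z < X w)%R]ltNge (le_trans Xt (ltW tz)).
    apply: integral_itv_bndo_bndc.
    by apply/measurable_EFinP; apply: measurable_funTS; under eq_fun do rewrite mul1r.
  rewrite integral_expR// -EFinD mul1r addrC subrK /u; congr (expR _)%:E.
  rewrite /b; have [tX|Xt] := leP t (X w).
    by rewrite max_r ?subr_le0//; ring.
  by rewrite max_l ?subr_ge0 ?ltW//; ring.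
have IF0 w : 0 <= \int[lebesgue_measure]_z F (w, z) by exact: integral_ge0.
have mIF : measurable_fun setT (fun w => \int[lebesgue_measure]_z F (w, z)).
  exact: (measurable_fun_fubini_tonelli_F (m2 := lebesgue_measure) F mF F0).
have -> : \int[Q]_(w in ~` N) u w =
    \int[Q]_(w in ~` N) ((expR (- c * t))%:E + \int[lebesgue_measure]_z F (w, z)).
  by apply: eq_integral => w; rewrite inE => /contrapT; exact: uE.
rewrite -offN; last 2 first.
- by apply: emeasurable_funD => //; exact: measurable_cst.
- by move=> w; rewrite adde_ge0// lee_fin expR_ge0.
have e0 : 0 <= (expR (- c * t))%:E by rewrite lee_fin expR_ge0.
rewrite ge0_integralD//.
rewrite integral_cst// [X in _ * (_ * X + _)]QT mule1.
rewrite (fubini_tonelli (m1 := Q) (m2 := lebesgue_measure) F mF F0).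
have -> : \int[lebesgue_measure]_z \int[Q]_w F (w, z) =
    \int[lebesgue_measure]_(z in `[0%R, t]) (g z * expR (- mu * z))%:E.
  rewrite [RHS]integral_mkcond; apply: eq_integral => z _.
  rewrite patchE mem_setE in_itv/= /F /=.
  case: (leP 0%R z) => [z0|_] /=; last by rewrite integral0.
  case: (leP z t) => [zt|_] /=; last by rewrite integral0.
  transitivity (\int[Q]_(w in [set w | (z < X w)%R]) cst (g z)%:E w).
    rewrite [RHS]integral_mkcond; apply: eq_integral => w _.
    by rewrite patchE mem_setE.
  by rewrite integral_cst// [X in _ * X](QX _ z0) EFinM.
rewrite ge0_muleDr ?lee_fin ?expR_ge0//; last first.
  by apply: integral_ge0 => z _; rewrite lee_fin mulr_ge0// expR_ge0.
rewrite -ge0_integralZl_EFin//; last 2 first.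
- by move=> z _; rewrite lee_fin mulr_ge0// expR_ge0.
- apply: measurable_funTS; apply/measurable_EFinP; apply: measurable_funM => //.
  by apply: measurableT_comp => //; apply: measurable_funM.
transitivity (p%:E * (expR (- c * t))%:E + \int[lebesgue_measure]_(z in `[0%R, t])
  (- (1 - p) * (- (mu * p) * expR (- c * t + - (mu * p) * z)))%:E +
  (1 - p)%:E * Q [set w | (t < X w)%R]).
  congr (_ + _ + _); apply: eq_integral => z _; rewrite -EFinM; congr EFin.
  rewrite /g -mulrA -expRD.
  rewrite (_ : - c * t + c * z + - mu * z = - c * t + - (mu * p) * z)%R.
    by rewrite /c; ring.
  by rewrite /c; ring.
rewrite integral_expR// (QX _ t0) -!EFinM -!EFinD; congr EFin.
rewrite (_ : - c * t + - (mu * p) * t = - mu * t)%R; first by ring.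
by rewrite /c; ring.
Qed.

End Mixture.

Section First_failure.
Context (R : realType).
Implicit Types (E : probability R R).
Local Open Scope ereal_scope.

Lemma survival_min rate rate' E E' (m : R) : exp_law rate E -> exp_law rate' E' ->
  (0 <= m)%R ->
  (E \x E') [set z | (m < Num.min z.1 z.2)%R] = (expR (- (rate + rate') * m))%:E.
Proof.
move=> HE HE' m0.
have -> : [set z : R * R | (m < Num.min z.1 z.2)%R] =
    `]m, +oo[%classic `*` `]m, +oo[%classic.
  by apply/seteqP; split=> -[x y] /=; rewrite lt_min !in_itv/= !andbT;
    [move/andP|move=> [-> ->]].
rewrite product_measure1E//.
rewrite [X in X * _](HE _ m0) [X in _ * X](HE' _ m0) -EFinM -expRD.
by congr (expR _)%:E; ring.
Qed.

(** The balance equation of state 0: the stay is the minimum of x and y, and the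
    race between z and r that decides whether the cycle is the last one is
    independent of it. *)
Lemma first_failure_balance rate rate' E E' E'' (p t : R) :
  exp_law rate E -> exp_law rate' E' -> (0 < rate + rate')%R -> (0 <= p <= 1)%R ->
  \int[E]_l \int[E'']_r (if (r < l)%R then 1 else 0) = p%:E ->
  let u (t : R) := (expR (- ((rate + rate') * (1 - p)) * Num.max t 0))%R in
  \int[E]_x \int[E']_y \int[E]_l \int[E'']_r
    (if (r < l)%R then (u (t - Num.min x y)%R)%:E
     else if (t < Num.min x y)%R then 1 else 0) = (u t)%:E.
Proof.
move=> HE HE' rr p01 pE u.
have [p0 p1] := andP p01.
pose X (z : R * R) : R := Num.min z.1 z.2.
have mX : measurable_fun setT X by rewrite /X; mfun.
pose v (z : R * R) : R := u (t - X z)%R.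
pose b (z : R * R) : R := if (t < X z)%R then 1%R else 0%R.
have v0 z : (0 <= v z)%R by rewrite expR_ge0.
have b0 z : (0 <= b z)%R by rewrite /b; case: ifP.
have mv : measurable_fun setT v.
  rewrite /v /u.
  apply: measurableT_comp => //; apply: measurable_funM => //.
  by apply: measurable_maxr => //; apply: measurable_funB.
have mb : measurable_fun setT b by rewrite /b; mfun.
pose f (z : R * R) : \bar R := p%:E * (v z)%:E + (1 - p)%:E * (b z)%:E.
have q0 : (0 <= 1 - p)%R by rewrite subr_ge0.
have f0 z : 0 <= f z by rewrite adde_ge0// mule_ge0// lee_fin.
have mf : measurable_fun setT f.
  by apply: emeasurable_funD; apply: measurable_funeM; exact/measurable_EFinP.
transitivity (\int[E]_x \int[E']_y f (x, y)).
  apply: eq_integral => x _; apply: eq_integral => y _.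
  rewrite /f -!EFinM -EFinD -(race_cst pE (v0 (x, y)) (b0 (x, y))).
  apply: eq_integral => l _; apply: eq_integral => r _.
  by rewrite /v /b /X /=; case: ifP => // _; case: ifP.
rewrite -(fubini_tonelli1 f mf f0).
rewrite ge0_integralD//; last 4 first.
- by move=> z _; rewrite mule_ge0// lee_fin.
- by apply: measurable_funeM; exact/measurable_EFinP.
- by move=> z _; rewrite mule_ge0// lee_fin.
- by apply: measurable_funeM; exact/measurable_EFinP.
rewrite !ge0_integralZl_EFin//; last 4 first.
- by move=> z _; rewrite lee_fin.
- exact/measurable_EFinP.
- by move=> z _; rewrite lee_fin.
- exact/measurable_EFinP.
have -> : \int[E \x E']_z (b z)%:E = (E \x E') [set z | (t < X z)%R].
  have mB : measurable [set z | (t < X z)%R].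
    rewrite [Y in measurable Y](_ : _ = X @^-1` `]t, +oo[); last first.
      by apply/seteqP; split=> w /=; rewrite in_itv/= andbT.
    by rewrite -[_ @^-1` _]setTI; exact: mX.
  rewrite -[RHS]mul1e -integral_cst// [RHS]integral_mkcond.
  apply: eq_integral => z _; rewrite patchE (_ : (z \in _) = (t < X z)%R)//.
    by rewrite /b; case: ifP.
  by apply/idP/idP; rewrite inE.
have QX (m : R) : (0 <= m)%R -> (E \x E') [set z | (m < X z)%R] =
    (expR (- (rate + rate') * m))%:E by exact: survival_min.
exact: (exp_thinning t mX rr p01 QX).
Qed.

End First_failure.

(** * Independence of the past and a family of variables *)

Lemma bigcap_eqtype_seq (T : Type) (I : eqType) (s : seq I) (F : I -> set T) :
  \bigcap_(i in [set` s]) F i = \big[setI/setT]_(i <- s) F i.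
Proof.
elim: s => [|j s IH]; first by rewrite big_nil; apply/seteqP; split.
rewrite big_cons -IH; apply/seteqP; split=> [t H|t [tj H]].
  split; first by apply: H; rewrite /= mem_head.
  by move=> i /= si; apply: H; rewrite /= inE si orbT.
by move=> i /=; rewrite inE => /predU1P[->|/H].
Qed.

Section Independence.
Context (d : measure_display) (T : measurableType d) (R : realType).
Context (P : probability T R) (I : eqType) (X : I -> {RV P >-> R}).
Local Open Scope ereal_scope.

(** Z is independent of the subfamily of X indexed by J. In a recursion that reads
    the variables one at a time, J consists of indices not yet read; this avoids
    the sub-sigma-algebra generated by the past. *)
Definition indep_of (dS : measure_display) (S : measurableType dS) (Z : T -> S)
    (J : {pred I}) : Prop :=
  forall (s : seq I) (A : set S) (B : I -> set R),
    uniq s -> {subset s <= J} -> measurable A -> (forall i, measurable (B i)) ->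
    P (Z @^-1` A `&` \bigcap_(i in [set` s]) (X i @^-1` B i)) =
    P (Z @^-1` A) * \prod_(i <- s) P (X i @^-1` B i).

Lemma measurable_cylinder (s : seq I) (B : I -> set R) :
  (forall i, measurable (B i)) ->
  measurable (\bigcap_(i in [set` s]) (X i @^-1` B i)).
Proof.
move=> mB; rewrite bigcap_eqtype_seq; apply: bigsetI_measurable => i _.
by rewrite -[_ @^-1` _]setTI; exact: measurable_funP.
Qed.

Section Pair.
Context (dS : measure_display) (S : measurableType dS) (Z : T -> S).
Hypothesis mZ : measurable_fun setT Z.
Variables (J : {pred I}) (j : I).
Hypotheses (ZJ : indep_of Z J) (jJ : j \in J).

Let W (w : T) : S * R := (Z w, X j w).
Let mW : measurable_fun setT W.
Proof. by apply: measurable_fun_pair => //; exact: measurable_funP. Qed.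
Let WX : {RV P >-> (S * R)%type} := HB.pack W (isMeasurableFun.Build _ _ _ _ W mW).
Let ZX : {RV P >-> S} := HB.pack Z (isMeasurableFun.Build _ _ _ _ Z mZ).

Let mpre (A : set (S * R)) : measurable A -> measurable (W @^-1` A).
Proof. by move=> mA; rewrite -[_ @^-1` _]setTI; exact: mW. Qed.

(** After X j has been read, the pair (Z, X j) is independent of the remaining
    variables: for a fixed cylinder C on these, both sides are measures in the
    event of the pair, and they agree on rectangles. *)
Lemma indep_pair (J' : {pred I}) : {subset J' <= J} -> j \notin J' ->
  indep_of (fun w => (Z w, X j w)) J'.
Proof.
move=> J'J jJ' s A B us sJ' mA mB.
pose C := \bigcap_(i in [set` s]) (X i @^-1` B i).
have mC : measurable C by exact: measurable_cylinder.
pose c : \bar R := \prod_(i <- s) P (X i @^-1` B i).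
have c0 : 0 <= c by apply: prode_ge0.
have cfin : c \is a fin_num.
  by apply: prode_fin_num => i _; apply: fin_num_measure; rewrite -[_ @^-1` _]setTI;
    exact: measurable_funP.
pose k : {nonneg R} := NngNum (fine_ge0 c0).
have -> : \prod_(i <- s) P (X i @^-1` B i) = k%:num%:E by rewrite /= fineK.
rewrite muleC.
apply: (measure_unique_prod (m1 := pushforward (mrestr P mC) WX)
  (m2 := mscale k (distribution P WX))) mA; last first.
  apply: (@le_lt_trans _ _ (P (W @^-1` setT `&` C))) => //.
  by rewrite ltey_eq fin_num_measure//; apply: measurableI => //; exact: mpre.
move=> A1 B1 mA1 mB1.
rewrite [LHS](_ : _ = P ((Z @^-1` A1 `&` X j @^-1` B1) `&` C))//.
rewrite [RHS](_ : _ = k%:num%:E * P (Z @^-1` A1 `&` X j @^-1` B1))//.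
have js : j \notin s by apply: contra jJ'; exact: sJ'.
pose B' i := if i == j then B1 else B i.
have mB' i : measurable (B' i) by rewrite /B'; case: ifP.
have B's : {in s, forall i, B' i = B i}.
  by move=> i si; rewrite /B'; case: eqP => // ij; rewrite -ij si in js.
have B'j : B' j = B1 by rewrite /B' eqxx.
have ZJ1 := @ZJ [:: j] A1 B'; rewrite bigcap_eqtype_seq !big_seq1 B'j in ZJ1.
have ZJ2 := @ZJ (j :: s) A1 B'; rewrite bigcap_eqtype_seq !big_cons B'j in ZJ2.
rewrite ZJ1//; last by move=> i; rewrite inE => /eqP ->.
rewrite /C bigcap_eqtype_seq -setIA.
rewrite (eq_big_seq (fun i => X i @^-1` B' i)); last by move=> i /B's ->.
rewrite ZJ2//=; last 2 first.
- by rewrite js.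
- by move=> i; rewrite inE => /predU1P[->//|/sJ'/J'J].
rewrite muleA muleC fineK//; congr (_ * _).
by apply: eq_big_seq => i /B's ->.
Qed.

(** Tonelli's theorem for the joint law of Z and a fresh variable. *)
Lemma integral_indep (E : probability R R) (f : S * R -> \bar R) :
  (forall A, measurable A -> P (X j @^-1` A) = E A) ->
  measurable_fun setT f -> (forall z, 0 <= f z) ->
  \int[P]_w f (Z w, X j w) = \int[P]_w \int[E]_x f (Z w, x).
Proof.
move=> XE mf f0.
transitivity (\int[distribution P WX]_z f z).
  by rewrite ge0_integral_distribution.
rewrite (eq_measure_integral (distribution P ZX \x E)); last first.
  move=> A mA _; apply/esym/product_measure_unique => // A1 B1 mA1 mB1.
  rewrite /distribution /pushforward /= -XE//.
  have := @ZJ [:: j] A1 (fun=> B1); rewrite bigcap_eqtype_seq !big_seq1; apply=> //.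
  by move=> i; rewrite inE => /eqP ->.
rewrite fubini_tonelli1// ge0_integral_distribution//.
  exact: measurable_fun_fubini_tonelli_F.
by move=> z; exact: integral_ge0.
Qed.

End Pair.

Lemma indep_comp (d1 d2 : measure_display) (S1 : measurableType d1)
    (S2 : measurableType d2) (Z : T -> S1) (f : S1 -> S2) (J : {pred I}) :
  measurable_fun setT f -> indep_of Z J -> indep_of (fun w => f (Z w)) J.
Proof.
move=> mf ZJ s A B us sJ mA mB.
have mfA : measurable (f @^-1` A) by rewrite -[_ @^-1` _]setTI; exact: mf.
exact: (ZJ s (f @^-1` A) B).
Qed.

Lemma indep_sub (dS : measure_display) (S : measurableType dS) (Z : T -> S)
    (J J' : {pred I}) : {subset J' <= J} -> indep_of Z J -> indep_of Z J'.
Proof. by move=> J'J ZJ s A B us sJ'; apply: ZJ => // i /sJ'/J'J. Qed.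

Lemma indep_single (j : I) (J : {pred I}) : mutually_independent X ->
  j \notin J -> indep_of (X j) J.
Proof.
move=> XI jJ s A B us sJ mA mB.
have js : j \notin s by apply: contra jJ; exact: sJ.
pose B' i := if i == j then A else B i.
have mB' i : measurable (B' i) by rewrite /B'; case: ifP.
have B's : {in s, forall i, B' i = B i}.
  by move=> i si; rewrite /B'; case: eqP => // ij; rewrite -ij si in js.
have B'j : B' j = A by rewrite /B' eqxx.
have := XI (j :: s) B'; rewrite bigcap_eqtype_seq !big_cons B'j => H.
rewrite bigcap_eqtype_seq (eq_big_seq (fun i => X i @^-1` B' i)); last first.
  by move=> i /B's ->.
rewrite H//= ?js//; congr (_ * _).
by apply: eq_big_seq => i /B's ->.
Qed.

End Independence.

(** * Recursion over the cycles *)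

Section Recursion.
Context (d : measure_display) (T : measurableType d) (R : realType).
Context (P : probability T R) (life standby repair : nat -> {RV P >-> R}).
Context (rate : R) (E E' E'' : probability R R).
Hypotheses (HE : exp_law rate E) (E'0 : positive_law E') (E''0 : positive_law E'').
Hypotheses (lifeE : forall n A, measurable A -> P (life n @^-1` A) = E A)
  (standbyE : forall n A, measurable A -> P (standby n @^-1` A) = E' A)
  (repairE : forall n A, measurable A -> P (repair n @^-1` A) = E'' A).
Hypothesis indep : mutually_independent (gather3 life standby repair).
Variable c : R -> R -> R.
Hypothesis mc : measurable_fun setT (fun p : R * R => c p.1 p.2).
Local Open Scope ereal_scope.

Local Notation X := (gather3 life standby repair).
Local Notation l w := (fun n => life n w).
Local Notation s w := (fun n => standby n w).
Local Notation g w := (fun n => repair n w).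

(** The past of cycle j as far as the future depends on it: whether there was
    no failure, the accumulated time, and the residual operating life. The standby life
    s (2j) is not part of it: it belongs to the variables not yet read. *)
Definition cycle_state (j : nat) (w : T) : (bool * R) * R :=
  ((alive (l w) (s w) (g w) j, acc (l w) (s w) (g w) c j), oplife0 (l w) (s w) (g w) j).

Definition cycle_input (j : nat) (w : T) : ((((bool * R) * R) * R) * R) * R :=
  (((cycle_state j w, standby j.*2 w), life j.*2.+1 w), repair j.*2.+1 w).

Definition cycle_map (p : ((((bool * R) * R) * R) * R) * R) : (bool * R) * R :=
  let b := p.1.1.1.1.1 in let a := p.1.1.1.1.2 in
  let x := p.1.1.1.2 in let y := p.1.1.2 in
  let x1 := residual x y p.1.2 in let r := p.2 in
  ((if (r < x1)%R then b else false, (a + c (Num.min x y) (Num.min x1 r))%R),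
   (x1 - r)%R).

Lemma cycle_stateS j w : cycle_state j.+1 w = cycle_map (cycle_input j w).
Proof.
rewrite /cycle_state /cycle_map /=; congr ((_, _), _).
  by rewrite andbC; case: ifP.
by rewrite /acc big_ord_recr.
Qed.

Lemma measurable_c (d' : measure_display) (T' : measurableType d') (x y : T' -> R) :
  measurable_fun setT x -> measurable_fun setT y ->
  measurable_fun setT (fun w => c (x w) (y w)).
Proof.
move=> mx my.
exact: (measurableT_comp (f := fun p : R * R => c p.1 p.2)
  (g := fun w => (x w, y w)) mc (measurable_fun_pair mx my)).
Qed.

Lemma measurable_cycle_map : measurable_fun setT cycle_map.
Proof.
rewrite /cycle_map /residual; mfun; apply: measurable_c; mfun.
Qed.

(** All these variables are still unread at the start of cycle j. *)
Definition future (j : nat) : {pred (nat + nat + nat)%type} :=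
  fun i => match i with
  | inl (inl n) => (j.*2 < n)%N
  | inl (inr n) => (j.*2 <= n)%N
  | inr n => (j.*2 < n)%N
  end.

Let I : eqType := (nat + nat + nat)%type.
Let i1 j : I := inl (inr j.*2).
Let i2 j : I := inl (inl j.*2.+1).
Let i3 j : I := inr j.*2.+1.
Let f1 j : {pred I} := [predD1 future j & i1 j].
Let f2 j : {pred I} := [predD1 f1 j & i2 j].
Let f3 j : {pred I} := [predD1 f2 j & i3 j].

Let f3P j : {subset future j.+1 <= f3 j}.
Proof.
move=> i; rewrite !inE -!topredE /= /i1 /i2 /i3.
case: i => [[n|n]|n]; rewrite /future /= doubleS => h.
- have n1 : n != j.*2.+1 by apply/eqP => n1; move: h; rewrite n1 ltnNge leqnSn.
  apply/andP; split; last by apply: ltn_trans h; rewrite ltnS.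
  by apply: contra n1 => /eqP[->].
- apply/andP; split; last by apply: leq_trans h; rewrite ltnW.
  by apply/eqP => -[n1]; move: h; rewrite n1 ltnNge leqnSn.
- apply/andP; split; last by apply: ltn_trans h; rewrite ltnS.
  by apply/eqP => -[n1]; move: h; rewrite n1 ltnNge leqnSn.
Qed.

Let W1 j w := (cycle_state j w, standby j.*2 w).
Let W2 j w := (W1 j w, life j.*2.+1 w).

Let subD1 (A : {pred I}) i : {subset [predD1 A & i] <= A}.
Proof. by move=> k; rewrite !inE => /andP[]. Qed.

Let notD1 (A : {pred I}) i : i \notin [predD1 A & i].
Proof. by rewrite !inE eqxx. Qed.

Let i1P j : i1 j \in future j.
Proof. by rewrite -topredE /= leqnn. Qed.

Let i2P j : i2 j \in f1 j.
Proof. by rewrite !inE -topredE /= ltnS leqnn. Qed.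

Let i3P j : i3 j \in f2 j.
Proof. by rewrite !inE -topredE /= ltnS leqnn. Qed.

Let measurable_RV (Y : {RV P >-> R}) : measurable_fun setT Y.
Proof. exact: measurable_funP. Qed.

Let spec j := measurable_fun setT (cycle_state j) /\
  indep_of X (cycle_state j) (future j).

Let spec1 j : spec j -> measurable_fun setT (W1 j) /\ indep_of X (W1 j) (f1 j).
Proof.
move=> [mZ ZJ]; split; first exact: measurable_fun_pair.
exact: (indep_pair mZ ZJ (i1P j) (@subD1 _ _) (@notD1 _ _)).
Qed.

Let spec2 j : spec j -> measurable_fun setT (W2 j) /\ indep_of X (W2 j) (f2 j).
Proof.
move=> /spec1[mZ ZJ]; split; first exact: measurable_fun_pair.
exact: (indep_pair mZ ZJ (i2P j) (@subD1 _ _) (@notD1 _ _)).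
Qed.

Let spec3 j : spec j ->
  measurable_fun setT (cycle_input j) /\ indep_of X (cycle_input j) (f3 j).
Proof.
move=> /spec2[mZ ZJ]; split; first exact: measurable_fun_pair.
exact: (indep_pair mZ ZJ (i3P j) (@subD1 _ _) (@notD1 _ _)).
Qed.

Lemma cycle_state_spec j :
  measurable_fun setT (cycle_state j) /\ indep_of X (cycle_state j) (future j).
Proof.
elim: j => [|j /spec3[mW WJ]].
  pose f (x : R) : (bool * R) * R := ((true, 0%R), x).
  have ZE : cycle_state 0 = (fun w => f (life 0%N w)).
    by apply/funext => w; rewrite /cycle_state /f /acc big_ord0.
  have mf : measurable_fun setT f by rewrite /f; mfun.
  rewrite ZE; split; first exact: (measurableT_comp mf).
  apply: indep_comp => //.
  exact: (indep_single (j := inl (inl 0%N)) (J := future 0) indep).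
have -> : cycle_state j.+1 = (fun w => cycle_map (cycle_input j w)).
  by apply/funext => w; exact: cycle_stateS.
split; first exact: (measurableT_comp measurable_cycle_map).
apply: (indep_comp measurable_cycle_map).
exact: (indep_sub (@f3P j)).
Qed.

(** The three variables read during a cycle are integrated out one by one. *)
Lemma integral_cycle_input j (f : ((((bool * R) * R) * R) * R) * R -> \bar R) :
  measurable_fun setT f -> (forall z, 0 <= f z) ->
  \int[P]_w f (cycle_input j w) =
  \int[P]_w \int[E']_y \int[E]_z \int[E'']_r f (((cycle_state j w, y), z), r).
Proof.
move=> mf f0.
have sp := cycle_state_spec j.
pose g2 p := \int[E'']_r f (p, r).
have g20 p : 0 <= g2 p by exact: integral_ge0.
have mg2 : measurable_fun setT g2 := measurable_fun_fubini_tonelli_F f mf f0.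
pose g1 p := \int[E]_z g2 (p, z).
have g10 p : 0 <= g1 p by exact: integral_ge0.
have mg1 : measurable_fun setT g1 := measurable_fun_fubini_tonelli_F g2 mg2 g20.
have [mZ1 ZJ1] := spec1 sp; have [mZ2 ZJ2] := spec2 sp; have [mZ ZJ] := sp.
transitivity (\int[P]_w g2 (W2 j w)).
  exact: (integral_indep mZ2 ZJ2 (i3P j) (repairE _) mf f0).
transitivity (\int[P]_w g1 (W1 j w)).
  exact: (integral_indep mZ1 ZJ1 (i2P j) (lifeE _) mg2 g20).
exact: (integral_indep mZ ZJ (i1P j) (standbyE _) mg1 g10).
Qed.

(** On the event that cycle j takes place, the residual operating life is
    exponential and independent of the past; the event is encoded by test
    functions that vanish off it. *)
Definition fresh_life (j : nat) : Prop :=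
  forall f : (bool * R) * R -> \bar R,
  measurable_fun setT f -> (forall z, 0 <= f z) ->
  (forall a x, f ((false, a), x) = 0) ->
  \int[P]_w f (cycle_state j w) =
  \int[P]_w \int[E]_x f ((cycle_state j w).1, x).

(** On a cycle that starts in state 0 with a fresh life, the duration of state
    0, the residual life and the repair time are independent. *)
Lemma integral_cycle j (h : ((R * R) * R) * R -> \bar R) :
  fresh_life j -> measurable_fun setT h -> (forall z, 0 <= h z) ->
  \int[P]_w (if alive (l w) (s w) (g w) j then
      h (((acc (l w) (s w) (g w) c j, stay0 (l w) (s w) (g w) j),
          oplife1 (l w) (s w) (g w) j), repair j.*2.+1 w) else 0) =
  \int[P]_w (if alive (l w) (s w) (g w) j then
     \int[E]_x \int[E']_y \int[E]_z \int[E'']_r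
       h (((acc (l w) (s w) (g w) c j, Num.min x y), z), r) else 0).
Proof.
move=> Fj mh h0.
have h00 (b : bool) z : 0 <= (if b then h z else 0) by case: b.
pose f (p : ((((bool * R) * R) * R) * R) * R) : \bar R :=
  if p.1.1.1.1.1 then
    h (((p.1.1.1.1.2, Num.min p.1.1.1.2 p.1.1.2), residual p.1.1.1.2 p.1.1.2 p.1.2), p.2)
  else 0.
have mf : measurable_fun setT f by rewrite /f /residual; mfun.
have f0 p : 0 <= f p by exact: h00.
transitivity (\int[P]_w f (cycle_input j w)); first by apply: eq_integral.
rewrite (integral_cycle_input j mf f0).
pose g3 p := \int[E'']_r f (p, r).
have g30 p : 0 <= g3 p by exact: integral_ge0.
have mg3 : measurable_fun setT g3 := measurable_fun_fubini_tonelli_F f mf f0.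
pose g2 p := \int[E]_z g3 (p, z).
have g20 p : 0 <= g2 p by exact: integral_ge0.
have mg2 : measurable_fun setT g2 := measurable_fun_fubini_tonelli_F g3 mg3 g30.
pose g1 p := \int[E']_y g2 (p, y).
have g10 p : 0 <= g1 p by exact: integral_ge0.
have mg1 : measurable_fun setT g1 := measurable_fun_fubini_tonelli_F g2 mg2 g20.
transitivity (\int[P]_w g1 (cycle_state j w)); first by [].
rewrite (Fj g1 mg1 g10); last first.
  move=> a x; apply: integral0_eq => y _; apply: integral0_eq => z _.
  exact: integral0_eq.
apply: eq_integral => w _; rewrite /cycle_state /=.
case: ifP => aw; last first.
  apply: integral0_eq => x _.
  rewrite /g1; apply: integral0_eq => y _; apply: integral0_eq => z _.
  exact: integral0_eq.
set a := acc _ _ _ _ _.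
pose k (q : (R * R) * R) := h (((a, q.1.1), q.1.2), q.2).
have mk : measurable_fun setT k by rewrite /k; mfun.
pose H q := \int[E'']_r k (q, r).
have H0 q : 0 <= H q by apply: integral_ge0 => r _; exact: h0.
have mH : measurable_fun setT H := measurable_fun_fubini_tonelli_F k mk (fun=> h0 _).
transitivity (\int[E]_x \int[E']_y \int[E]_z
    H (Num.min x y, if (y < x)%R then (x - y)%R else z)).
  apply: eq_integral => x _; apply: eq_integral => y _; apply: eq_integral => z _.
  by apply: eq_integral.
transitivity (\int[E]_x \int[E']_y \int[E]_z H (Num.min x y, z)).
  exact: (residual_fresh HE E'0 mH H0).
apply: eq_integral => x _; apply: eq_integral => y _; apply: eq_integral => z _.
by apply: eq_integral.
Qed.

(** If cycle j is not the last one, cycle j + 1 starts with the overshoot of the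
    repair time by the operating life, which is fresh by [overshoot_fresh]. *)
Lemma fresh_life_all j : fresh_life j.
Proof.
elim: j => [|j Fj] f mf f0 fF.
  pose k (x : R) := f ((true, 0%R), x).
  have mk : measurable_fun setT k by exact: measurable_fun_pair2.
  transitivity (\int[P]_w (k \o life 0%N) w).
    by apply: eq_integral => w _; rewrite /cycle_state /acc big_ord0.
  rewrite -ge0_integral_distribution//; last by move=> x; exact: f0.
  transitivity (\int[E]_x k x).
    by apply: eq_measure_integral => A mA _; exact: lifeE.
  transitivity (\int[P]_w cst (\int[E]_x k x) w).
    by rewrite integral_cst// [X in _ * X](@probability_setT _ _ _ P) mule1.
  by apply: eq_integral => w _; rewrite /cycle_state /acc big_ord0.
pose F a := \int[E]_x f ((true, a), x).
have F0 a : 0 <= F a by exact: integral_ge0.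
have mF : measurable_fun setT F.
  pose f' (q : R * R) := f ((true, q.1), q.2).
  have mf' : measurable_fun setT f' by rewrite /f'; mfun.
  exact: (measurable_fun_fubini_tonelli_F f' mf' (fun=> f0 _)).
pose h1 (q : ((R * R) * R) * R) : \bar R := if (q.2 < q.1.2)%R then
  f ((true, q.1.1.1 + c q.1.1.2 (Num.min q.1.2 q.2)), q.1.2 - q.2)%R else 0.
pose h2 (q : ((R * R) * R) * R) : \bar R := if (q.2 < q.1.2)%R then
  F (q.1.1.1 + c q.1.1.2 (Num.min q.1.2 q.2))%R else 0.
have mh1 : measurable_fun setT h1 by rewrite /h1; mfun; apply: measurable_c; mfun.
have mh2 : measurable_fun setT h2 by rewrite /h2; mfun; apply: measurable_c; mfun.
have h10 q : 0 <= h1 q by rewrite /h1; case: ifP.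
have h20 q : 0 <= h2 q by rewrite /h2; case: ifP.
transitivity (\int[P]_w (if alive (l w) (s w) (g w) j then
      h1 (((acc (l w) (s w) (g w) c j, stay0 (l w) (s w) (g w) j),
          oplife1 (l w) (s w) (g w) j), repair j.*2.+1 w) else 0)).
  apply: eq_integral => w _; rewrite cycle_stateS /cycle_map /h1 /=.
  by case: (alive _ _ _ j); case: ifP => // _; rewrite fF.
rewrite (integral_cycle Fj mh1 h10).
transitivity (\int[P]_w (if alive (l w) (s w) (g w) j then
      h2 (((acc (l w) (s w) (g w) c j, stay0 (l w) (s w) (g w) j),
          oplife1 (l w) (s w) (g w) j), repair j.*2.+1 w) else 0)); last first.
  apply: eq_integral => w _; rewrite cycle_stateS /cycle_map /h2 /F /=.
  case: (alive _ _ _ j); case: ifP => // _; apply/esym; apply: integral0_eq => x _;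
  exact: fF.
transitivity (\int[P]_w (if alive (l w) (s w) (g w) j then
     \int[E]_x \int[E']_y \int[E]_z \int[E'']_r
       h2 (((acc (l w) (s w) (g w) c j, Num.min x y), z), r) else 0)); last first.
  exact/esym/(integral_cycle Fj mh2 h20).
apply: eq_integral => w _; case: (alive _ _ _ j); last by [].
apply: eq_integral => x _; apply: eq_integral => y _.
set a := acc _ _ _ _ _; set m := Num.min x y.
pose h (q : R * R) := f ((true, (a + c m q.1)%R), q.2).
have mcm : measurable_fun setT (fun z : R => c m z) by apply: measurable_c; mfun.
have mh : measurable_fun setT h by rewrite /h; mfun.
transitivity (\int[E]_z \int[E'']_r (if (r < z)%R then h (r, z - r)%R else 0)).
  apply: eq_integral => z _; apply: eq_integral => r _; rewrite /h1 /h /=.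
  by case: ltP => // rz.
transitivity (\int[E]_z \int[E'']_r
    (if (r < z)%R then \int[E]_v h (r, v) else 0)).
  exact: (overshoot_fresh (k := fun=> 0) HE E''0 mh (fun=> f0 _)).
apply: eq_integral => z _; apply: eq_integral => r _; rewrite /h2 /F /h /=.
by case: ltP => // rz.
Qed.

Lemma measurable_alive j :
  measurable_fun setT (fun w => alive (l w) (s w) (g w) j).
Proof.
have [mZ _] := cycle_state_spec j.
exact: (measurableT_comp measurable_fst (measurableT_comp measurable_fst mZ)).
Qed.

Lemma measurable_acc j :
  measurable_fun setT (fun w => acc (l w) (s w) (g w) c j).
Proof.
have [mZ _] := cycle_state_spec j.
exact: (measurableT_comp measurable_snd (measurableT_comp measurable_fst mZ)).
Qed.

Lemma measurable_oplife0 j : measurable_fun setT (fun w => oplife0 (l w) (s w) (g w) j).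
Proof.
have [mZ _] := cycle_state_spec j.
exact: (measurableT_comp measurable_snd mZ).
Qed.

Lemma measurable_oplife1 j : measurable_fun setT (fun w => oplife1 (l w) (s w) (g w) j).
Proof.
have mx := measurable_oplife0 j; rewrite /oplife1 /residual.
have my := measurable_RV (standby j.*2); have mz := measurable_RV (life j.*2.+1).
apply: measurable_fun_ifT => //; first exact: measurable_fun_ltr.
exact: measurable_funB.
Qed.

Let measurable_set_bool (b : T -> bool) : measurable_fun setT b ->
  measurable [set w | b w].
Proof.
move=> mb; rewrite [X in measurable X](_ : _ = b @^-1` [set true])//.
by rewrite -[_ @^-1` _]setTI; exact: mb.
Qed.

Let integral_bool (b : T -> bool) : measurable_fun setT b ->
  P [set w | b w] = \int[P]_w (if b w then 1 else 0).
Proof.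
move=> mb; have mB := measurable_set_bool mb.
rewrite -[LHS]mul1e -integral_cst// integral_mkcond.
apply: eq_integral => w _; rewrite patchE (_ : (w \in _) = b w)//.
by apply/idP/idP; rewrite inE.
Qed.

Let measurable_alive_set j : measurable [set w | alive (l w) (s w) (g w) j].
Proof. exact/measurable_set_bool/measurable_alive. Qed.

Let integral_const2 (k : \bar R) :
  \int[E]_x \int[E']_y (cst k) y = k.
Proof.
transitivity (\int[E]_x cst k x).
  apply: eq_integral => x _.
  by rewrite integral_cst// [X in _ * X](@probability_setT _ _ _ E') mule1.
by rewrite integral_cst// [X in _ * X](@probability_setT _ _ _ E) mule1.
Qed.

Variable p : R.
Hypothesis pE : \int[E]_z \int[E'']_r (if (r < z)%R then 1 else 0) = p%:E.

Lemma prob_alive j : P [set w | alive (l w) (s w) (g w) j] = (p ^+ j)%:E.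
Proof.
elim: j => [|j IH].
  by rewrite (_ : [set w | _] = setT) ?probability_setT//; apply/seteqP; split.
rewrite integral_bool; last exact: measurable_alive.
pose h (q : ((R * R) * R) * R) : \bar R := if (q.2 < q.1.2)%R then 1 else 0.
have mh : measurable_fun setT h by rewrite /h; mfun.
have h0 q : 0 <= h q by rewrite /h; case: ifP.
transitivity (\int[P]_w (if alive (l w) (s w) (g w) j then
      h (((acc (l w) (s w) (g w) c j, stay0 (l w) (s w) (g w) j),
          oplife1 (l w) (s w) (g w) j), repair j.*2.+1 w) else 0)).
  by apply: eq_integral => w _ /=; case: (alive _ _ _ j).
etransitivity; first exact: (integral_cycle (@fresh_life_all j) mh h0).
transitivity (\int[P]_w (p%:E * (if alive (l w) (s w) (g w) j then 1 else 0))).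
  apply: eq_integral => w _; case: (alive _ _ _ j); last by rewrite mule0.
  rewrite mule1 -[RHS](integral_const2 p%:E).
  apply: eq_integral => x _; apply: eq_integral => y _; exact: pE.
rewrite ge0_integralZl_EFin//; last 3 first.
- by move=> w _; case: ifP.
- by apply: measurable_fun_ifT => //; exact: measurable_alive.
- by have /andP[] := race_prob01 pE.
by rewrite -integral_bool ?IH ?exprS ?EFinM//; exact: measurable_alive.
Qed.

(** A tie would start a state 2 of duration zero, which the trajectory would not
    show. *)
Lemma tie_negligible j : (forall r : R, E [set r] = 0) ->
  P.-negligible [set w | alive (l w) (s w) (g w) j /\
                         oplife1 (l w) (s w) (g w) j = repair j.*2.+1 w].
Proof.
move=> Eatom.
pose b w := if alive (l w) (s w) (g w) j
  then oplife1 (l w) (s w) (g w) j == repair j.*2.+1 w else false.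
have mb : measurable_fun setT b.
  apply: measurable_fun_ifT => //; first exact: measurable_alive.
  apply: measurable_fun_eqr; first exact: measurable_oplife1.
  exact: measurable_RV.
rewrite (_ : [set w | _] = [set w | b w]); last first.
  apply/seteqP; split=> w /=; rewrite /b.
    by move=> [-> ->].
  by case: (alive _ _ _ j) => // /eqP.
apply/negligibleP; first exact: measurable_set_bool.
apply: (etrans (integral_bool mb)).
pose h (q : ((R * R) * R) * R) : \bar R := if q.1.2 == q.2 then 1 else 0.
have mh : measurable_fun setT h.
  rewrite /h; apply: measurable_fun_ifT => //; apply: measurable_fun_eqr => //.
  by mfun.
have h0 q : 0 <= h q by rewrite /h; case: ifP.
transitivity (\int[P]_w (if alive (l w) (s w) (g w) j then
      h (((acc (l w) (s w) (g w) c j, stay0 (l w) (s w) (g w) j),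
          oplife1 (l w) (s w) (g w) j), repair j.*2.+1 w) else 0)).
  by apply: eq_integral => w _; rewrite /b /h /=; case: (alive _ _ _ j).
etransitivity; first exact: (integral_cycle (@fresh_life_all j) mh h0).
apply: integral0_eq => w _; case: (alive _ _ _ j) => //.
apply: integral0_eq => x _; apply: integral0_eq => y _.
pose k (q : R * R) : \bar R := if q.1 == q.2 then 1 else 0.
have mk : measurable_fun setT k.
  by rewrite /k; apply: measurable_fun_ifT => //; exact: measurable_fun_eqr.
have k0 q : 0 <= k q by rewrite /k; case: ifP.
transitivity (\int[E]_z \int[E'']_r k (z, r)); first by [].
rewrite (fubini_tonelli (m1 := E) (m2 := E'') k mk k0).
apply: integral0_eq => r _.
rewrite -(Eatom r) -[RHS]mul1e -integral_cst// [RHS]integral_mkcond.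
apply: eq_integral => z _; rewrite patchE /k /=.
by rewrite (_ : (z \in _) = (z == r))//; apply/idP/eqP; rewrite inE.
Qed.

Variable u : R -> R.
Hypotheses (mu : measurable_fun setT u) (u0 : forall t, (0 <= u t)%R)
  (u1 : forall t, (u t <= 1)%R).
Hypothesis balance : forall t : R,
  \int[E]_x \int[E']_y \int[E]_z \int[E'']_r
    (if (r < z)%R then (u (t - c (Num.min x y) (Num.min z r)))%:E
     else if (t < c (Num.min x y) (Num.min z r))%R then 1 else 0) = (u t)%:E.

(** Cycle j ends the busy period, and the time accumulated by then exceeds t. *)
Definition last_cycle (t : R) (j : nat) : set T :=
  [set w | [/\ alive (l w) (s w) (g w) j, ~~ alive (l w) (s w) (g w) j.+1 &
              (t < acc (l w) (s w) (g w) c j.+1)%R]].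

Let bool_last t j w := if alive (l w) (s w) (g w) j
  then if alive (l w) (s w) (g w) j.+1 then false
       else (t < acc (l w) (s w) (g w) c j.+1)%R else false.

Let measurable_bool_last t j : measurable_fun setT (bool_last t j).
Proof.
apply: measurable_fun_ifT => //; first exact: measurable_alive.
apply: measurable_fun_ifT => //; first exact: measurable_alive.
by apply: measurable_fun_ltr => //; exact: measurable_acc.
Qed.

Let last_cycleE t j : last_cycle t j = [set w | bool_last t j w].
Proof.
apply/seteqP; split=> w /=; rewrite /last_cycle /bool_last /=.
  by move=> [-> /negbTE -> ->].
by case: (alive _ _ _ j); case: (_ < oplife1 _ _ _ j)%R.
Qed.

Lemma measurable_last_cycle t j : measurable (last_cycle t j).
Proof. by rewrite last_cycleE; exact: measurable_set_bool. Qed.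

Let Q t j := \int[P]_w (if alive (l w) (s w) (g w) j
  then (u (t - acc (l w) (s w) (g w) c j))%:E else 0).

Let measurable_Q t j : measurable_fun setT (fun w => if alive (l w) (s w) (g w) j
  then (u (t - acc (l w) (s w) (g w) c j))%:E else 0).
Proof.
apply: measurable_fun_ifT => //; first exact: measurable_alive.
apply/measurable_EFinP; apply: (measurableT_comp mu).
by apply: measurable_funB => //; exact: measurable_acc.
Qed.

(** One cycle replaces u of the remaining time by its expectation after the cycle,
    which is u again by the balance equation. *)
Lemma balance_step t j : Q t j = Q t j.+1 + P (last_cycle t j).
Proof.
rewrite last_cycleE integral_bool//.
pose h (q : ((R * R) * R) * R) : \bar R := if (q.2 < q.1.2)%R then
  (u (t - (q.1.1.1 + c q.1.1.2 (Num.min q.1.2 q.2))))%:E else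
  if (t < q.1.1.1 + c q.1.1.2 (Num.min q.1.2 q.2))%R then 1 else 0.
have mh : measurable_fun setT h by rewrite /h; mfun; apply: measurable_c; mfun.
have h0 q : 0 <= h q.
  by rewrite /h; case: ifP => _; [rewrite lee_fin|case: ifP].
rewrite /Q -ge0_integralD//; last 3 first.
- by move=> w _; case: ifP => // _; rewrite lee_fin.
- by move=> w _; case: ifP.
- exact: measurable_fun_ifT.
transitivity (\int[P]_w (if alive (l w) (s w) (g w) j then
      h (((acc (l w) (s w) (g w) c j, stay0 (l w) (s w) (g w) j),
          oplife1 (l w) (s w) (g w) j), repair j.*2.+1 w) else 0)); last first.
  apply: eq_integral => w _; rewrite /bool_last /acc big_ord_recr /= /h /stay1 /=.
  case: (alive _ _ _ j) => /=; last by rewrite adde0.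
  by case: ifP => _; rewrite ?adde0 ?add0e.
apply/esym; etransitivity; first exact: (integral_cycle (@fresh_life_all j) mh h0).
apply: eq_integral => w _; case: (alive _ _ _ j) => //.
set a := acc _ _ _ _ _; rewrite -balance.
apply: eq_integral => x _; apply: eq_integral => y _.
apply: eq_integral => z _; apply: eq_integral => r _.
by rewrite /h /= opprD addrA ltrBlDl.
Qed.

Lemma trivIset_last_cycle t : trivIset setT (last_cycle t).
Proof.
apply: ltn_trivIset => j i ij; rewrite -subset0 => w [[_ di _] [aj _ _]].
by move: di; rewrite (alive_le ij aj).
Qed.

(** Telescoping [balance_step]: the remainder Q t j is at most p^j. *)
Lemma prob_last_cycle t : (p < 1)%R -> (0 <= t)%R ->
  P (\bigcup_j last_cycle t j) = (u t)%:E.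
Proof.
move=> p_lt1 t0; have /andP[p0 _] := race_prob01 pE.
have Q0 j : 0 <= Q t j.
  by apply: integral_ge0 => w _; case: ifP => // _; rewrite lee_fin.
have Qle j : Q t j <= (p ^+ j)%:E.
  rewrite -prob_alive integral_bool; last exact: measurable_alive.
  apply: ge0_le_integral => //.
  - by move=> w _; case: ifP => // _; rewrite lee_fin.
  - by apply: measurable_fun_ifT => //; exact: measurable_alive.
  - by move=> w _; case: ifP => // _; rewrite lee_fin.
have Qfin j : Q t j \is a fin_num.
  by rewrite ge0_fin_numE// (le_lt_trans (Qle j))// ltry.
have Qinit : Q t 0 = (u t)%:E.
  transitivity (\int[P]_w cst (u t)%:E w).
    by apply: eq_integral => w _ /=; rewrite /acc big_ord0 subr0.
  by rewrite integral_cst// [X in _ * X](@probability_setT _ _ _ P) mule1.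
have sumE n : \sum_(0 <= j < n) P (last_cycle t j) = (u t - fine (Q t n))%:E.
  elim: n => [|n IH]; first by rewrite big_nil Qinit /= subrr.
  rewrite big_nat_recr//= IH.
  have mL : P (last_cycle t n) \is a fin_num.
    by apply: fin_num_measure; exact: measurable_last_cycle.
  have := balance_step t n.
  rewrite -(fineK (Qfin n)) -(fineK (Qfin n.+1)) -(fineK mL) -!EFinD => -[->] /=.
  by congr EFin; lra.
rewrite measure_bigcup//; last first.
- exact: trivIset_last_cycle.
- by move=> j _; exact: measurable_last_cycle.
apply/cvg_lim => //; rewrite (_ : (fun n : nat => _) =
  (fun n => (u t - fine (Q t n))%:E)); last first.
  by apply/funext => n; rewrite -sumE; apply: eq_bigl => j; rewrite in_setT.
apply: cvg_EFin; first by near=> n.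
rewrite -[X in _ --> X](subr0 (u t)).
apply: cvgB; first exact: cvg_cst.
apply: (@squeeze_cvgr _ _ _ _ (fun=> 0%R) (fun n => p ^+ n)%R).
- near=> n; apply/andP; split; first exact: fine_ge0.
  by rewrite -lee_fin fineK.
- exact: cvg_cst.
- by apply: cvg_expr; rewrite ger0_norm.
Unshelve. all: by end_near.
Qed.

Lemma always_alive_negligible : (p < 1)%R ->
  P.-negligible (\bigcap_j [set w | alive (l w) (s w) (g w) j]).
Proof.
move=> p_lt1; have /andP[p0 _] := race_prob01 pE.
set A := \bigcap_j _.
have mA : measurable A by apply: bigcapT_measurable.
have Ale n : P A <= (p ^+ n)%:E.
  rewrite -prob_alive; apply: le_measure; rewrite ?inE//.
  by move=> w; apply.
have Afin : P A \is a fin_num by exact: fin_num_measure.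
suff PA0 : P A = 0 by apply/negligibleP.
apply/eqP; rewrite eq_le measure_ge0 andbT -(fineK Afin) lee_fin.
have p_to0 : (fun n => p ^+ n)%R @ \oo --> (0%R : R).
  by apply: cvg_expr; rewrite ger0_norm.
apply: (cvgr_to_ge p_to0).
by near=> n; rewrite -lee_fin fineK.
Unshelve. all: by end_near.
Qed.

End Recursion.

(** * The laws of the occupation times *)

Section Laws.
Context (R : realType).
Local Open Scope ereal_scope.

Lemma exponential_exp_law (rate : R) (E : probability R R) :
  (forall A, measurable A -> E A = exponential_prob rate A) ->
  exp_law rate E /\ forall r : R, E [set r] = 0.
Proof.
move=> EE.
have E1 (r : R) : E [set r] = 0 by rewrite EE// /exponential_prob integral_set1.
split=> // x x0.
rewrite -setCitvl probability_setC//.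
have -> : E `]-oo, x]%classic = (1 - expR (- rate * x))%:E.
  rewrite (_ : `]-oo, x]%classic = `]-oo, 0%R[%classic `|` `[0%R, x]%classic); last first.
    apply/seteqP; split=> y /=; rewrite !in_itv/=.
      by have [y0|y0] := ltP y 0%R; [left|right].
    by case=> [y0|/andP[]//]; rewrite (le_trans (ltW y0)).
  rewrite measureU//; last first.
    rewrite -subset0 => y [] /=; rewrite !in_itv/= => y0 /andP[].
    by rewrite leNgt y0.
  rewrite [X in X + _](_ : _ = 0) ?add0e; last first.
    apply: (etrans (EE _ _)) => //; apply: integral0_eq => y /=.
    by rewrite in_itv/= => y0; rewrite lt0_exponential_pdf.
  move: x0; rewrite le_eqVlt => /predU1P[<-|x0].
    by rewrite set_itv1 mulr0 expR0 subrr; exact: E1.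
  by apply: (etrans (EE _ _)) => //; rewrite exponential_prob_itv0c.
by rewrite -EFinB opprB addrC subrK.
Qed.

Lemma eq_prob_off_negligible (d : measure_display) (T : measurableType d)
    (P : probability T R) (N A B : set T) : P.-negligible N ->
  measurable A -> measurable B -> (forall w, ~ N w -> A w <-> B w) -> P A = P B.
Proof.
move=> [M [mM M0 NM]] mA mB AB.
have le (C D : set T) : measurable C -> measurable D ->
    (forall w, ~ N w -> C w -> D w) -> P C <= P D.
  move=> mC mD CD; rewrite -(measureU0 mD mM M0).
  apply: le_measure; rewrite ?inE//; first exact: measurableU.
  move=> w Cw; have [/NM Mw|Nw] := pselect (N w); [by right|left].
  exact: CD Cw.
by apply/eqP; rewrite eq_le !le// => w Nw; have [] := AB w Nw.
Qed.

Section Race_probability.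
Context (rate p : R) (E E'' : probability R R).
Hypotheses (rate0 : (0 < rate)%R) (HE : exp_law rate E) (E''0 : positive_law E'').
Hypothesis pE : \int[E'']_(x in `[0%R, +oo[) (expR (- rate * x))%:E = p%:E.

Let mexp : measurable_fun setT (fun x : R => (expR (- rate * x))%:E).
Proof.
by apply/measurable_EFinP; apply: measurableT_comp.
Qed.

Lemma race_probE : \int[E]_z \int[E'']_r (if (r < z)%R then 1 else 0) = p%:E.
Proof.
pose f (q : R * R) : \bar R := if (q.2 < q.1)%R then 1 else 0.
have mf : measurable_fun setT f.
  by rewrite /f; apply: measurable_fun_ifT => //; exact: measurable_fun_ltr.
have f0 q : 0 <= f q by rewrite /f; case: ifP.
transitivity (\int[E]_z \int[E'']_r f (z, r)); first by [].
rewrite (fubini_tonelli (m1 := E) (m2 := E'') f mf f0) -pE.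
rewrite [RHS]integral_mkcond.
apply: (positive_law_eq_integral (f := fun r => \int[E]_z f (z, r)) E''0).
- exact: (measurable_fun_fubini_tonelli_G (m1 := E) f mf f0).
- apply/(measurable_restrictT _ (measurable_itv _)).
  exact: measurable_funTS.
- by move=> r; exact: integral_ge0.
- by move=> r; rewrite patchE; case: ifP => // _; rewrite lee_fin expR_ge0.
move=> r r0; rewrite patchE mem_setE in_itv/= andbT (ltW r0).
by rewrite /f /= -probability_rayE HE// ltW.
Qed.

(** The function 1 - exp(- rate r) is positive for r > 0, so that its integral
    against a positive law does not vanish. *)
Lemma race_prob_lt1 : (p < 1)%R.
Proof.
have /andP[p0 p1] := race_prob01 race_probE.
rewrite lt_neqAle p1 andbT; apply/eqP => p_eq1.
pose D : set R := `[0%R, +oo[%classic.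
have mD : measurable D by exact: measurable_itv.
have ED : E'' D = 1.
  apply/eqP; rewrite eq_le; apply/andP; split; first exact: (probability_le1 _ mD).
  apply: (@le_trans _ _ (E'' `]0%R, +oo[%classic)).
    by rewrite positive_law_ray.
  apply: le_measure; rewrite ?inE// => x; rewrite /D /= !in_itv/= !andbT; exact: ltW.
pose h (x : R) : R := (1 - expR (- rate * x))%R.
have hD x : D x -> (0 <= h x)%R.
  rewrite /D /= in_itv/= andbT => x0.
  by rewrite subr_ge0 -expR0 ler_expR mulNr oppr_le0 mulr_ge0// ltW.
have mh : measurable_fun setT (EFin \o h).
  apply/measurable_EFinP; apply: measurable_funB => //.
  by have /measurable_EFinP := mexp.
have h0 : \int[E'']_(x in D) (h x)%:E = 0.
  have : \int[E'']_(x in D) (cst 1) x = p%:E + \int[E'']_(x in D) (h x)%:E.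
    rewrite -pE -ge0_integralD//.
    - by apply: eq_integral => x _; rewrite -EFinD /h addrC subrK.
    - exact: (measurable_funTS mexp).
    - exact: (measurable_funTS mh).
  rewrite integral_cst// [X in _ * X]ED mule1 p_eq1.
  case: (\int[E'']_(x in D) _) => [r|//|//] [r1]; congr EFin.
  by move: r1; lra.
have mhD : measurable_fun D (EFin \o h) := measurable_funTS mh.
have [N [mN N0 hN]] : ae_eq E'' D (EFin \o h) (cst 0).
  apply/(ae_eq_integral_abs E'' mD mhD); rewrite -[RHS]h0.
  by apply: eq_integral => x; rewrite inE => Dx; rewrite gee0_abs// lee_fin hD.
have : E'' `]0%R, +oo[%classic <= E'' N.
  apply: le_measure; rewrite ?inE// => x /=; rewrite in_itv/= andbT => x0.
  apply: hN => /= H.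
  have /H[] : D x by rewrite /D /= in_itv/= andbT ltW.
  apply/eqP; rewrite /h subr_eq0 eq_sym lt_eqF// -expR0 ltr_expR.
  by rewrite mulNr oppr_lt0 mulr_gt0.
by rewrite N0 (positive_law_ray E''0)// lee_fin ler10.
Qed.

End Race_probability.
End Laws.

Section Occupation_law.
Context (d : measure_display) (T : measurableType d) (R : realType).
Context (P : probability T R) (life standby repair : nat -> {RV P >-> R}).
Context (rate : R) (E E' E'' : probability R R).
Hypotheses (HE : exp_law rate E) (Eatom : forall r : R, E [set r] = 0%E).
Hypotheses (E'0 : positive_law E') (E''0 : positive_law E'').
Hypotheses (lifeE : forall n A, measurable A -> P (life n @^-1` A) = E A)
  (standbyE : forall n A, measurable A -> P (standby n @^-1` A) = E' A)
  (repairE : forall n A, measurable A -> P (repair n @^-1` A) = E'' A).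
Hypothesis indep : mutually_independent (gather3 life standby repair).
Local Open Scope ereal_scope.

Local Notation path F w :=
  (F (fun n => life n w) (fun n => standby n w) (fun n => repair n w)).

Let nonpos_negligible (Y : nat -> {RV P >-> R}) (L : probability R R) :
  positive_law L -> (forall n A, measurable A -> P (Y n @^-1` A) = L A) ->
  P.-negligible (\bigcup_n [set w | (Y n w <= 0)%R]).
Proof.
move=> L0 YL; apply: negligible_bigcup => n.
exists (Y n @^-1` `]-oo, 0%R]); split.
- by rewrite -[_ @^-1` _]setTI; exact: measurable_funP.
- exact: (etrans (YL _ _ _)).
- by move=> w /=; rewrite in_itv.
Qed.

(** Off a negligible set the clocks are positive, there is no tie and some cycle is
    the last one, and there alpha exceeds t exactly when the time accumulated up to
    the end of the last cycle does. *)
Lemma prob_alpha (k : nat) (p : R) (u : R -> R) (t : R) : (k < 2)%N ->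
  \int[E]_z \int[E'']_r (if (r < z)%R then 1 else 0) = p%:E -> (p < 1)%R ->
  measurable_fun setT u -> (forall t, (0 <= u t <= 1)%R) ->
  (forall t : R, \int[E]_x \int[E']_y \int[E]_z \int[E'']_r
    (if (r < z)%R then
       (u (t - (if k == 0%N then Num.min x y else Num.min z r)))%:E
     else if (t < (if k == 0%N then Num.min x y else Num.min z r))%R
          then 1 else 0) = (u t)%:E) ->
  (0 <= t)%R ->
  P [set w | t%:E < path (@alpha R) w k] = (u t)%:E.
Proof.
move=> k2 pE p1 mu u01 bal t0.
have u0 x : (0 <= u x)%R by have /andP[] := u01 x.
have u1 x : (u x <= 1)%R by have /andP[] := u01 x.
pose c (m n : R) : R := if k == 0%N then m else n.
have mc : measurable_fun setT (fun q : R * R => c q.1 q.2).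
  by rewrite /c; case: (k == 0%N); [exact: measurable_fst|exact: measurable_snd].
rewrite -(prob_last_cycle HE E'0 E''0 lifeE standbyE repairE indep mc pE mu u0 u1
  bal p1 t0).
have E0 := exp_law_positive HE.
have Nl := nonpos_negligible E0 lifeE.
have Ns := nonpos_negligible E'0 standbyE.
have Nr := nonpos_negligible E''0 repairE.
have Nt := negligible_bigcup (fun j => tie_negligible HE E'0 E''0 lifeE standbyE
  repairE indep mc j Eatom).
have Na := always_alive_negligible HE E'0 E''0 lifeE standbyE repairE indep mc pE p1.
apply: (eq_prob_off_negligible
  (negligibleU Nl (negligibleU Ns (negligibleU Nr (negligibleU Nt Na))))).
- rewrite -[X in measurable X]setTI; apply: measurable_lte => //.
  by apply: measurable_alpha => n; exact: measurable_funP.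
- apply: bigcupT_measurable => j.
  exact: (measurable_last_cycle indep mc).
move=> w off.
have l_gt0 n : (0 < life n w)%R.
  by rewrite ltNge; apply/negP => h; apply: off; left; exists n.
have s_gt0 n : (0 < standby n w)%R.
  by rewrite ltNge; apply/negP => h; apply: off; right; left; exists n.
have g_gt0 n : (0 < repair n w)%R.
  by rewrite ltNge; apply/negP => h; apply: off; right; right; left; exists n.
have alphaE j : path (@alive R) w j -> ~~ path (@alive R) w j.+1 ->
    path (@alpha R) w k = (path (@acc R) w c j.+1)%:E.
  move=> aj nj; apply: alpha_cycles => //.
  rewrite lt_neqAle; apply/andP; split.
    by apply/eqP => tie; apply: off; right; right; right; left; exists j.
  by move: nj => /=; rewrite aj /= -leNgt.
split=> /= [ta|[j _ [aj nj tj]]]; last by rewrite (alphaE j)// lte_fin.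
pose dead n := ~~ path (@alive R) w n.
have exdead : exists n, dead n.
  apply: contrapT => nex; apply: off; do 4 right; move=> j _ /=.
  by apply: contrapT => /negP nj; apply: nex; exists j.
have [[|j] nj jmin] := ex_minnP exdead; first by [].
have aj : path (@alive R) w j.
  by apply: contraT => naj; have := jmin j naj; rewrite ltnn.
by exists j => //; split=> //; move: ta; rewrite (alphaE j)// lte_fin.
Qed.

End Occupation_law.

Theorem mainTheorem7 (R : realType) (d : measure_display)
    (T : measurableType d) (P : probability T R)
    (lambda lambda' : R)
    (lambda_gt0 : 0 < lambda) (lambda'_gt0 : 0 < lambda')
    (lambda'_lt : lambda' < lambda)
    (* dG is the probability measure on the line with distribution function G *)
    (G : R -> R) (dG : probability (measurableTypeR R) R)
    (dGE : forall t : R, dG `]-oo, t[%classic = (G t)%:E)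
    (G0 : G x @[x --> 0^'+] --> (0 : R))
    (* operating lives, standby lives, repair times *)
    (life standby repair : nat -> {RV P >-> R})
    (lifeE : forall (n : nat) (A : set R), measurable A ->
       distribution P (life n) A = exponential_prob lambda A)
    (standbyE : forall (n : nat) (A : set R), measurable A ->
       distribution P (standby n) A = exponential_prob lambda' A)
    (repairE : forall (n : nat) (t : R),
       P [set w | repair n w < t] = (G t)%:E)
    (indep : mutually_independent (gather3 life standby repair)) :
  let q : R := 1 - \int[dG]_(x in `[0, +oo[) expR (- lambda * x) in
  let alpha_ (k : nat) (w : T) : \bar R :=
    alpha (fun n => life n w) (fun n => standby n w) (fun n => repair n w) k in
  forall t : R, 0 <= t ->
    P [set w | (t%:E < alpha_ 0%N w)%E] = (expR (- (lambda + lambda') * q * t))%:E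
    /\
    P [set w | (t%:E < alpha_ 1%N w)%E] = (expR (- lambda * t))%:E.
Proof.
move=> q alpha_ t t0.
pose E : probability R R := distribution P (life 0%N).
pose E' : probability R R := distribution P (standby 0%N).
pose E'' : probability R R := distribution P (repair 0%N).
have expE n A : measurable A -> P (life n @^-1` A) = E A.
  by move=> mA; rewrite [LHS](lifeE n)// [RHS](lifeE 0%N).
have expE' n A : measurable A -> P (standby n @^-1` A) = E' A.
  by move=> mA; rewrite [LHS](standbyE n)// [RHS](standbyE 0%N).
have [HE Eatom] := exponential_exp_law (fun A mA => lifeE 0%N A mA : E A = _).
have [HE' _] := exponential_exp_law (fun A mA => standbyE 0%N A mA : E' A = _).
have ltE n (x : R) : P (repair n @^-1` `]-oo, x[%classic) = (G x)%:E.
  rewrite -(repairE n x) (_ : _ @^-1` _ = [set w | repair n w < x])//.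
have expE'' n A : measurable A -> P (repair n @^-1` A) = E'' A.
  move=> mA; apply: (@measure_unique_rays_lt _ (distribution P (repair n))) => //.
    by move=> x; rewrite [LHS]ltE [RHS]ltE.
  by move=> x; rewrite [X in (X < _)%E](ltE n x) ltry.
(* G(0+) = 0 bounds the probability of a nonpositive repair time *)
have E''0 : positive_law E''.
  rewrite /positive_law; set A := `]-oo, 0]%classic.
  have mA : measurable A by exact: measurable_itv.
  have Afin : E'' A \is a fin_num by exact: fin_num_measure.
  apply/eqP; rewrite eq_le measure_ge0 andbT -(fineK Afin) lee_fin.
  apply: (cvgr_to_ge G0); near=> x.
  rewrite -lee_fin fineK// -(ltE 0%N x); apply: le_measure.
  - by rewrite inE.
  - by rewrite inE; exact: measurable_itv.
  - move=> y; rewrite /A /= !in_itv/= => y0.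
    by apply: le_lt_trans y0 _; near: x; exact: nbhs_right_gt.
pose p := 1 - q.
have mexp : measurable_fun setT (fun x : R => (expR (- lambda * x))%:E).
  by apply/measurable_EFinP; apply: measurableT_comp.
have pE : (\int[E'']_(x in `[0%R, +oo[) (expR (- lambda * x))%:E = p%:E)%E.
  (* dG lives on another copy of the Borel line than the law of the repair time;
     the identity transports it *)
  pose X0f (x : measurableTypeR R) : R := x.
  have mX0f : measurable_fun setT X0f by move=> _ A mA; rewrite setTI.
  pose X0 : {mfun (measurableTypeR R) >-> R} :=
    HB.pack X0f (isMeasurableFun.Build _ _ _ _ X0f mX0f).
  pose D0 : probability R R := distribution dG X0.
  have E''D A : measurable A -> E'' A = D0 A.
    apply: measure_unique_rays_lt => x.
      by rewrite [LHS]ltE [RHS]dGE.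
    by rewrite [X in (X < _)%E](ltE 0%N x) ltry.
  rewrite (eq_measure_integral D0); last by move=> A mA _; exact: E''D.
  have VE : (\int[D0]_(x in `[0%R, +oo[) (expR (- lambda * x))%:E =
      \int[dG]_(x in `[0%R, +oo[) (expR (- lambda * x))%:E)%E.
    rewrite ge0_integral_pushforward//; exact: (measurable_funTS mexp).
  rewrite VE /p /q subKr /Rintegral fineK// -VE.
  rewrite ge0_fin_numE; last first.
    by apply: integral_ge0 => x _; rewrite lee_fin expR_ge0.
  apply: (@le_lt_trans _ _ (\int[D0]_(x in `[0%R, +oo[) (cst 1 x))%E).
    apply: ge0_le_integral => //.
    - exact: (measurable_funTS mexp).
    - move=> x /=; rewrite in_itv/= andbT => x0; rewrite lee_fin -expR0 ler_expR.
      by rewrite mulNr oppr_le0 mulr_ge0// ltW.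
  rewrite integral_cst// mul1e ltey_eq; apply/orP; left.
  by apply: fin_num_measure; exact: measurable_itv.
have rE := race_probE HE E''0 pE.
have p1 := race_prob_lt1 lambda_gt0 HE E''0 pE.
have p01 := race_prob01 rE.
have E'0 := exp_law_positive HE'.
have mmax (k : R) : measurable_fun setT (fun x : R => expR (- k * Num.max x 0)).
  apply: measurableT_comp => //; apply: measurable_funM => //.
  exact: measurable_maxr.
have max01 (k : R) : 0 <= k -> forall x : R, 0 <= expR (- k * Num.max x 0) <= 1.
  move=> k0 x; rewrite expR_ge0 -expR0 ler_expR mulNr oppr_le0 mulr_ge0//.
  by rewrite le_max lexx orbT.
have rates_gt0 : 0 < lambda + lambda' by exact: addr_gt0.
split.
- have q0 : 0 <= (lambda + lambda') * (1 - p).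
    by rewrite mulr_ge0 ?(ltW rates_gt0)// subr_ge0 ltW.
  rewrite (prob_alpha HE Eatom E'0 E''0 expE expE' expE'' indep (k := 0%N)
    (u := fun x => expR (- ((lambda + lambda') * (1 - p)) * Num.max x 0))
    isT rE p1 (mmax _) (max01 _ q0) _ t0).
    by rewrite max_l// /p subKr !mulNr.
  move=> x; exact: (first_failure_balance x HE HE' rates_gt0 p01 rE).
- rewrite (prob_alpha HE Eatom E'0 E''0 expE expE' expE'' indep (k := 1%N)
    (u := fun x => expR (- lambda * Num.max x 0))
    isT rE p1 (mmax _) (max01 _ (ltW lambda_gt0)) _ t0).
    by rewrite max_l.
  have rayE (x : R) : E `]x, +oo[%classic = (expR (- lambda * Num.max x 0))%:E.
    have [x0|x0] := leP x 0; first by rewrite (positive_law_ray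
      (exp_law_positive HE) x0) mulr0 expR0.
    by rewrite HE// ltW.
  move=> x; rewrite -rayE -(race_balance x HE E''0).
  transitivity (\int[E]_y (cst (\int[E]_z \int[E'']_r
     (if (r < z)%R then E `](x - Num.min z r)%R, +oo[%classic
      else if (x < Num.min z r)%R then 1 else 0)) y))%E.
    apply: eq_integral => y _.
    transitivity (\int[E']_y (cst (\int[E]_z \int[E'']_r
     (if (r < z)%R then E `](x - Num.min z r)%R, +oo[%classic
      else if (x < Num.min z r)%R then 1 else 0)) y))%E.
      apply: eq_integral => y' _; apply: eq_integral => z _; apply: eq_integral => r _.
      by rewrite -rayE.
    by rewrite integral_cst// [X in (_ * X)%E](@probability_setT _ _ _ E') mule1.
  by rewrite integral_cst// [X in (_ * X)%E](@probability_setT _ _ _ E) mule1.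
Unshelve. all: by end_near.
Qed.
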